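(* Let $n,k,Q$ be positive integers, let $B\subseteq\mathbb R^n$ be a Lebesgue measurable set without isolated points, and let $f\colon B\to\mathcal A_Q(\mathbb R^k)$ be a measurable function. Define, for $x\in B$, $$\operatorname{Lip} f(x)=\limsup_{y\in B,\ y\to x}\frac{\mathcal G\big(f(y),f(x)\big)}{|y-x|},\qquad A_f=\{x\in B:\ \operatorname{Lip} f(x)<+\infty\}.$$ Then $f$ is differentiable at Lebesgue-almost every point of $A_f$.
   Context: $\mathcal A_Q(\mathbb R^k)$ denotes the set of unordered $Q$-tuples of points of $\mathbb R^k$, i.e. measures of the form $\sum_{i=1}^Q[\![P_i]\!]$ (sum of $Q$ Dirac masses, not necessarily distinct). It is equipped with the metric $\mathcal G\big(\sum_i[\![A_i]\!],\sum_i[\![B_i]\!]\big)=\min_{\sigma}\sqrt{\sum_{i=1}^Q |A_i-B_{\sigma(i)}|^2}$, the minimum taken over all permutations $\sigma$ of $\{1,\dots,Q\}$; measurability of $f$ refers to the Borel $\sigma$-algebra of this metric space. A function $f\colon B\to\mathcal A_Q(\mathbb R^k)$ is differentiable at $x\in B$ with $f(x)=\sum_{i=1}^Q[\![P_i]\!]$ if there exist $k\times n$ matrices $M_1,\dots,M_Q$ such that, setting $F(z)=\sum_{i=1}^Q[\![P_i+M_iz]\!]$, one has $\lim_{y\in B,\ y\to x}\mathcal G\big(f(y),F(y-x)\big)/|y-x|=0$, and moreover $P_i=P_j$ implies $M_i=M_j$. *)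

(* Defs.v *)
From HB Require Import structures.
From mathcomp Require Import all_boot all_order all_algebra all_fingroup.
From mathcomp Require Import all_classical all_reals all_analysis.
Set Implicit Arguments. Unset Strict Implicit. Unset Printing Implicit Defensive.
Import Order.TTheory GRing.Theory Num.Theory.
Local Open Scope classical_set_scope.
Local Open Scope ring_scope.

Definition eucl (R : realType) (m : nat) (v : 'rV[R]_m) : R :=
  Num.sqrt (\sum_(i < m) (v ord0 i) ^+ 2).

(* A Q-tuple of points of R^k, representing sum_i [[P i]] in A_Q(R^k);
   all quantities below are invariant under reindexing. *)
Definition QTup (R : realType) (Q k : nat) := 'I_Q -> 'rV[R]_k.

Definition Gsq_perm (R : realType) (Q k : nat) (A B : QTup R Q k)
  (s : {perm 'I_Q}) : R :=
  \sum_(i < Q) (eucl (A i - B (s i))) ^+ 2.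

Definition Gdist (R : realType) (Q k : nat) (A B : QTup R Q k) : R :=
  Num.sqrt (\big[Num.min/Gsq_perm A B 1%g]_(s : {perm 'I_Q}) Gsq_perm A B s).

Definition G_open (R : realType) (Q k : nat) (U : set (QTup R Q k)) : Prop :=
  forall A, U A -> exists2 e : R, 0 < e & forall B, Gdist A B < e -> U B.

Definition G_borel (R : realType) (Q k : nat) : set (set (QTup R Q k)) :=
  <<s @G_open R Q k >>.

Definition box (R : realType) (n : nat) (a b : 'rV[R]_n) : set 'rV[R]_n :=
  [set x | forall i, a ord0 i <= x ord0 i <= b ord0 i].

Definition boxvol (R : realType) (n : nat) (a b : 'rV[R]_n) : R :=
  \prod_(i < n) Num.max 0 (b ord0 i - a ord0 i).

Definition leb_outer (R : realType) (n : nat) (E : set 'rV[R]_n) : \bar R :=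
  ereal_inf [set s | exists a b : nat -> 'rV[R]_n,
    E `<=` \bigcup_j box (a j) (b j) /\
    s = (\sum_(0 <= j <oo) (boxvol (a j) (b j))%:E)%E].

Definition leb_measurable (R : realType) (n : nat) (E : set 'rV[R]_n) : Prop :=
  forall A : set 'rV[R]_n,
    leb_outer A = (leb_outer (A `&` E) + leb_outer (A `\` E))%E.

Definition leb_null (R : realType) (n : nat) (N : set 'rV[R]_n) : Prop :=
  leb_outer N = 0%E.

Definition no_isolated (R : realType) (n : nat) (B : set 'rV[R]_n) : Prop :=
  forall x, B x -> forall d : R, 0 < d ->
    exists y, [/\ B y, y != x & eucl (y - x) < d].

Definition Qmeasurable (R : realType) (n Q k : nat) (B : set 'rV[R]_n)
  (f : 'rV[R]_n -> QTup R Q k) : Prop :=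
  forall U, G_borel U -> leb_measurable (B `&` f @^-1` U).

Definition Lipf (R : realType) (n Q k : nat) (B : set 'rV[R]_n)
  (f : 'rV[R]_n -> QTup R Q k) (x : 'rV[R]_n) : \bar R :=
  ereal_inf [set ereal_sup [set (Gdist (f y) (f x) / eucl (y - x))%:E
                           | y in [set y | B y /\ 0 < eucl (y - x) < d]]
            | d in [set d : R | 0 < d]].

Definition A_f (R : realType) (n Q k : nat) (B : set 'rV[R]_n)
  (f : 'rV[R]_n -> QTup R Q k) : set 'rV[R]_n :=
  [set x | B x /\ (Lipf B f x < +oo)%E].

Definition Qdifferentiable (R : realType) (n Q k : nat) (B : set 'rV[R]_n)
  (f : 'rV[R]_n -> QTup R Q k) (x : 'rV[R]_n) : Prop :=
  exists M : 'I_Q -> 'M[R]_(k, n),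
    (forall i j, f x i = f x j -> M i = M j) /\
    forall e : R, 0 < e -> exists2 d : R, 0 < d &
      forall y, B y -> 0 < eucl (y - x) < d ->
        Gdist (f y) (fun i => f x i + ((M i) *m (y - x)^T)^T)
          <= e * eucl (y - x).

(* Main.v *)
(* Stepanov's theorem is reduced to countably many Lipschitz problems. Split A_f
   into pieces on which, for fixed m, the estimate G(f(y), f(x)) <= m |y - x| holds
   for all y in B with |y - x| < 1/(m+1), distinct values of f(x) are 1/(m+1)-separated,
   and x and the values f x i are close to fixed rational points. On a piece the
   labels match, so each x |-> f x i is Lipschitz and extends to the whole space by
   McShane's formula. At a point x of a piece S where all the extensions are
   differentiable and dist(y, S) = o(|y - x|), replacing y by a nearby point of S
   gives the differentiability of f. No density theorem, hence no measurability, is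
   needed: the last condition holds almost everywhere on an arbitrary set S because
   dist(., S) is Lipschitz and vanishes on S.

   Rademacher's theorem is proved by the same device. A Lipschitz function has
   partial derivatives almost everywhere, by Fubini and the one-dimensional case.
   For the distance function this gives dist(x + t e_i, S) = o(t), and iterating over
   the coordinates dist(x + h, S) = o(|h|). Applied to the sets on which the difference
   quotients along the axes are uniformly close to fixed slopes, this lets one
   telescope F(x + h) - F(x) along the axes. *)
Require Import Defs.
From HB Require Import structures.
From mathcomp Require Import all_boot all_order all_algebra all_fingroup.
From mathcomp Require Import all_classical all_reals all_analysis.
From mathcomp Require Import ring lra.
Set Implicit Arguments. Unset Strict Implicit. Unset Printing Implicit Defensive.
Import Order.TTheory GRing.Theory Num.Theory.
Import numFieldNormedType.Exports.
Local Open Scope classical_set_scope.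
Local Open Scope ring_scope.

(** * Lipschitz functions of one variable *)

Lemma stieltjes_ocitv (R : realType) (f : cumulative R R) (a b : R) :
  a <= b -> lebesgue_stieltjes_measure f `]a, b] = (f b - f a)%:E.
Proof.
move=> ab; rewrite /lebesgue_stieltjes_measure/= /measure_extension.
by rewrite measurable_mu_extE/= ?wlength_itv_bnd//; exact: is_ocitv.
Qed.

(** Uniqueness of Lebesgue measure: both sides give a half-open interval its length. Hence each of
    the two Stieltjes measures vanishes on Lebesgue null sets. *)
Lemma stieltjes_complement (R : realType) (f1 f2 : cumulative R R) :
  (forall x, f1 x + f2 x = x) ->
  forall A : set (measurableTypeR R), measurable A ->
  lebesgue_measure A =
    (lebesgue_stieltjes_measure f1 A + lebesgue_stieltjes_measure f2 A)%E.
Proof.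
move=> f12 A mA.
rewrite (@lebesgue_measure_unique R (measure_add (lebesgue_stieltjes_measure f1)
  (lebesgue_stieltjes_measure f2)) _ A mA) => [|X /ocitvP[->|[[a b] /= ab ->]]].
- exact: measure_addE.
- by rewrite !measure0.
rewrite [RHS]measure_addE /lebesgue_measure !stieltjes_ocitv ?(ltW ab)//=.
rewrite (stieltjes_ocitv f1 (ltW ab)) (stieltjes_ocitv f2 (ltW ab)) -EFinD.
by congr EFin; rewrite -{1}(f12 b) -{1}(f12 a); ring.
Qed.

Lemma klipschitz_continuous (R : realType) (g : R -> R) (L : R) :
  (forall s t, `|g s - g t| <= L * `|s - t|) -> continuous g.
Proof.
move=> gL x; apply/cvgrPdist_le => e e0.
have L0 : 0 <= L by have := le_trans (normr_ge0 _) (gL 1 0); rewrite subr0 normr1 mulr1.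
near=> y.
apply: (le_trans (gL _ _)); rewrite (@le_trans _ _ ((L + 1) * `|x - y|))//.
  by rewrite ler_wpM2r// lerDl.
rewrite -ler_pdivlMl; last by rewrite ltr_wpDl.
near: y; apply: cvgr_dist_le; last by rewrite mulr_gt0// invr_gt0 ltr_wpDl.
exact: cvg_id.
Unshelve. all: by end_near. Qed.

(* [g + x/2] and [x/2 - g] are both nondecreasing and sum to the identity, so
   the Stieltjes measure of the first is dominated by Lebesgue measure, and its
   Radon-Nikodym density is the derivative. *)
Lemma half_lipschitz_ae_derivable (R : realType) (g : R -> R) :
  (forall s t, `|g s - g t| <= 2^-1 * `|s - t|) ->
  {ae @lebesgue_measure R, forall t, derivable g t 1}.
Proof.
move=> gL.
have gc := klipschitz_continuous gL.
pose f1 x := x / 2 + g x; pose f2 x := x / 2 - g x.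
have nd1 : {homo f1 : x y / x <= y}.
  move=> x y xy; rewrite /f1; have := gL x y.
  by rewrite (ler0_norm (_ : x - y <= 0)) ?subr_le0// ler_norml => /andP[_]; lra.
have nd2 : {homo f2 : x y / x <= y}.
  move=> x y xy; rewrite /f2; have := gL x y.
  by rewrite (ler0_norm (_ : x - y <= 0)) ?subr_le0// ler_norml => /andP[+ _]; lra.
have c1 : continuous f1.
  move=> x; apply: cvgD; last exact: gc.
  by apply: cvgM; [exact: cvg_id|exact: cvg_cst].
have c2 : continuous f2.
  move=> x; apply: cvgB; last exact: gc.
  by apply: cvgM; [exact: cvg_id|exact: cvg_cst].
pose F1 : cumulative R R := HB.pack f1
  (isCumulative.Build R _ R f1 nd1 (right_continuousW c1)).
pose F2 : cumulative R R := HB.pack f2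
  (isCumulative.Build R _ R f2 nd2 (right_continuousW c2)).
have F12 x : F1 x + F2 x = x by rewrite /= /f1 /f2; lra.
(* One bounded window at a time: there the Stieltjes measure of [f1] is finite, so it has an
   integrable density. *)
suff H (j : nat) : (@lebesgue_measure R).-negligible
    (~` [set t | - j%:R < t < j%:R -> derivable g t 1]).
  have [N [mN N0 NP]] : (@lebesgue_measure R).-negligible
      (\bigcup_j ~` [set t | - j%:R < t < j%:R -> derivable g t 1]).
    exact: negligible_bigcup.
  exists N; split => // t /= gt; apply: NP; exists (Num.bound t) => //=.
  by apply: contra_not gt; apply; rewrite -ltr_norml unstable.ltr_norm_bound.
pose D : set (measurableTypeR R) := `]- j%:R, j%:R]%classic.
have mD : measurable D by exact: measurable_itv.
have jj : - j%:R <= j%:R :> R by rewrite -subr_ge0 opprK addr_ge0.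
have Doo : (lebesgue_stieltjes_measure F1 D < +oo)%E.
  by rewrite stieltjes_ocitv// ltry.
pose nu := mfrestr mD Doo.
have numu : nu `<< @lebesgue_measure R.
  apply/null_content_dominatesP => A mA A0.
  have : (lebesgue_stieltjes_measure F1 (A `&` D) <=
          lebesgue_stieltjes_measure F1 A)%E.
    by apply: le_measure; rewrite ?inE//; exact: measurableI.
  have := stieltjes_complement F12 mA; rewrite [LHS]A0 => /esym/eqP.
  rewrite padde_eq0// => /andP[/eqP -> _] h.
  by apply/eqP; rewrite eq_le measure_ge0 andbT.
have [h [h0 hfin inth hE]] := radon_nikodym_sigma_finite numu.
have hEF : EFin \o (fine \o h) = h by apply/funext => x /=; rewrite fineK.
have intfh A : measurable A -> lebesgue_measure.-integrable A (EFin \o (fine \o h)).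
  by move=> mA; rewrite hEF; exact: integrableS inth.
(* Lebesgue differentiation: the primitive of the density based at [- j%:R] is differentiable almost
   everywhere. *)
have [N [mN N0 NP]] := @FTC1 R (fine \o h) (BRight (- j%:R))
  (fun y => intfh _ (measurable_itv _))
  (open_integrable_locally openT (intfh _ measurableT)).
exists N; split => // t /= gt; apply: NP; apply: contra_not gt => /= + /andP[jt tj].
move=> H; have [|dF _] := H; first by rewrite ?bnd_simp.
have -> : g = (fun x => f1 x - x / 2) by apply/funext => x; rewrite /f1; ring.
apply: (@derivableB _ R^o R^o); last exact: ex_derive.
rewrite -[f1](_ : (fun x => (f1 x - f1 (- j%:R)) + f1 (- j%:R)) = f1); last first.
  by apply/funext => x; rewrite subrK.
apply: (@derivableD _ R^o R^o); last exact: derivable_cst.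
(* Near [t] the primitive equals [f1 - f1 (- j%:R)], both being the [nu]-measure of the same
   interval. *)
apply: near_eq_derivable dF.
near=> y.
have jy : - j%:R < y by near: y; exact: lt_nbhsr.
have yj : y < j%:R by near: y; exact: lt_nbhsl.
have := hE `]- j%:R, y]%classic (measurable_itv _).
rewrite /nu /= /mfrestr /mrestr setIidl; last first.
  by apply: subset_itvl; rewrite bnd_simp ltW.
rewrite (stieltjes_ocitv F1 (ltW jy)) /= => fE.
rewrite /Rintegral -[RHS]/(fine (f1 y - f1 (- j%:R))%:E) fE.
by congr fine; apply: eq_integral => u _; rewrite fineK.
Unshelve. all: by end_near.
Qed.

(** Division by [2 * L] reduces to the constant 1/2; the derivative is then rewritten as an estimate
    on increments. *)
Lemma lipschitz_ae_difference_quotient (R : realType) (g : R -> R) (L : R) :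
  0 < L -> (forall s t, `|g s - g t| <= L * `|s - t|) ->
  exists2 N : set (measurableTypeR R),
    measurable N /\ lebesgue_measure N = 0%E &
    forall t, ~ N t -> exists a, forall e, 0 < e -> exists2 d, 0 < d &
      forall s, `|s| < d -> `|g (t + s) - g t - a * s| <= e * `|s|.
Proof.
move=> L0 gL.
have [|N [mN N0 NP]] := @half_lipschitz_ae_derivable R (fun t => g t / (2 * L)).
  move=> s t; rewrite -mulrBl normrM (@gtr0_norm _ (2 * L)^-1) ?invr_gt0 ?mulr_gt0//.
  rewrite ler_pdivrMr ?mulr_gt0//; apply: le_trans (gL s t) _.
  by rewrite le_eqVlt; apply/orP; left; apply/eqP; field.
exists N => // t Nt.
have : derivable (fun t => g t / (2 * L)) t 1.
  by apply: contrapT => nd; apply: Nt; apply: NP.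
move=> /cvg_ex[/= a /cvgrPdist_le ha]; exists (a * (2 * L)) => e e0.
have /ha : 0 < e / (2 * L) by rewrite divr_gt0 ?mulr_gt0.
move=> /nbhs_ballP[d /= d0 dP]; exists d => // s sd.
have [->|s0] := eqVneq s 0; first by rewrite addr0 subrr mulr0 subrr normr0 mulr0.
have := dP s; rewrite /ball/= sub0r normrN => /(_ sd s0).
rewrite /GRing.scale/= mulr1 (addrC s t) -mulrBl => h.
have s0' : 0 < `|s| by rewrite normr_gt0.
have -> : g (t + s) - g t - a * (2 * L) * s =
    - (2 * L * s * (a - s^-1 * ((g (t + s) - g t) / (2 * L)))).
  by field; rewrite s0 gt_eqF.
rewrite normrN normrM (normrM _ s) (gtr0_norm (mulr_gt0 _ L0))//.
apply: le_trans (ler_wpM2l _ h) _; first by rewrite !mulr_ge0// ltW.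
by rewrite le_eqVlt; apply/orP; left; apply/eqP; field; rewrite gt_eqF.
Qed.

(** * The outer measure *)

Lemma boxvol_ge0 (R : realType) n (a b : 'rV[R]_n) : 0 <= boxvol a b.
Proof. by apply: prodr_ge0 => i _; rewrite le_max lexx. Qed.

Lemma leb_outer_le (R : realType) n (E : set 'rV[R]_n) (a b : nat -> 'rV[R]_n) :
  E `<=` \bigcup_j box (a j) (b j) ->
  (leb_outer E <= \sum_(0 <= j <oo) (boxvol (a j) (b j))%:E)%E.
Proof. by move=> Eab; apply: ereal_inf_lbound; exists a, b. Qed.

Lemma leb_outer_cover (R : realType) n (E : set 'rV[R]_n) (s : \bar R) :
  (leb_outer E < s)%E -> exists a b : nat -> 'rV[R]_n,
    E `<=` \bigcup_j box (a j) (b j) /\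
    (\sum_(0 <= j <oo) (boxvol (a j) (b j))%:E < s)%E.
Proof.
by move=> /ereal_inf_lt[_ [a [b [Eab ->]]] abs]; exists a, b.
Qed.

Lemma leb_outer_ge0 (R : realType) n (E : set 'rV[R]_n) : (0 <= leb_outer E)%E.
Proof.
apply: le_ereal_inf_tmp => _ [a [b [_ ->]]].
by apply: nneseries_ge0 => j _ _; rewrite lee_fin boxvol_ge0.
Qed.

(* In dimension 0 every box has volume 1, so [leb_outer] is an outer measure
   only in positive dimension. *)
Lemma leb_outer_box_le (R : realType) n (a b : 'rV[R]_n.+1) :
  (leb_outer (box a b) <= (boxvol a b)%:E)%E.
Proof.
pose a' (j : nat) : 'rV[R]_n.+1 := if j is 0%N then a else 0.
pose b' (j : nat) : 'rV[R]_n.+1 := if j is 0%N then b else 0.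
have /leb_outer_le/le_trans : box a b `<=` \bigcup_j box (a' j) (b' j) by move=> x xab; exists 0%N.
apply.
rewrite nneseries_recl//; last by move=> j _; rewrite lee_fin boxvol_ge0.
rewrite eseries0 ?adde0// => -[//|j] _ _.
by rewrite /boxvol (bigD1 ord0)//= mxE subrr maxxx mul0r.
Qed.

Lemma leb_outer0 (R : realType) n : leb_outer (set0 : set 'rV[R]_n.+1) = 0%E.
Proof.
apply/eqP; rewrite eq_le leb_outer_ge0 andbT.
have v0 : boxvol (0 : 'rV[R]_n.+1) 0 = 0.
  by rewrite /boxvol (bigD1 ord0)//= mxE subrr maxxx mul0r.
have := leb_outer_box_le (0 : 'rV[R]_n.+1) 0; rewrite v0; apply: le_trans.
apply: le_ereal_inf => _ [a [b [_ ->]]]; exists a, b; split => // x [].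
Qed.

(** Each [F k] is covered with an excess of at most e/2^(k+1); a bijection of N with N x N merges
    the covers into one sequence of boxes. *)
Lemma leb_outer_sigma_subadditive (R : realType) n (A : set 'rV[R]_n)
    (F : (set 'rV[R]_n)^nat) : subset_sigma_subadditive (@leb_outer R n) A F.
Proof.
move=> AF; have [[i ioo]|] := pselect (exists i, leb_outer (F i) = +oo%E).
  by rewrite (eseries_pinfty _ _ ioo) ?leey// => k _; rewrite -ltNye
    (lt_le_trans _ (leb_outer_ge0 _)).
rewrite -forallNE => Foo.
apply/lee_addgt0Pr => e e0.
rewrite (le_trans _ (epsilon_trick _ _ (ltW e0)))//; last first.
  by move=> k; exact: leb_outer_ge0.
have /choice[G PG] : forall k, exists ab : (nat -> 'rV[R]_n) * (nat -> 'rV[R]_n),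
    F k `<=` \bigcup_j box (ab.1 j) (ab.2 j) /\
    (\sum_(0 <= j <oo) (boxvol (ab.1 j) (ab.2 j))%:E <=
      leb_outer (F k) + (e / (2 ^ k.+1)%:R)%:E)%E.
  move=> k; have [|a [b [ab1 ab2]]] := @leb_outer_cover R n (F k)
      (leb_outer (F k) + (e / (2 ^ k.+1)%:R)%:E)%E.
    rewrite lteDl ?lte_fin ?divr_gt0 ?ltr0n ?expn_gt0//.
    by rewrite ge0_fin_numE ?leb_outer_ge0// ltey; apply/eqP/Foo.
  by exists (a, b); split => //; exact: ltW.
have vol0 (p : nat * nat) : (0 <= (boxvol ((G p.1).1 p.2) ((G p.1).2 p.2))%:E)%E.
  by rewrite lee_fin boxvol_ge0.
have /card_esym/ppcard_eqP[f] := card_nat2.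
have /leb_outer_le/le_trans : A `<=`
    \bigcup_j box ((G (f j).1).1 (f j).2) ((G (f j).1).2 (f j).2).
  move=> x /AF[k _ /(PG k).1[j _ xj]].
  by exists (f^-1%FUN (k, j)) => //=; rewrite invK ?inE.
apply.
rewrite nneseries_esumT; last by move=> j; exact: (vol0 (f j)).
rewrite -(reindex_esum setT setT f
  (fun p => (boxvol ((G p.1).1 p.2) ((G p.1).2 p.2))%:E)) //.
rewrite -(_ : setT `*`` (fun=> setT) = setT :> set (nat * nat)); last first.
  by rewrite predeqE => -[? ?]; split.
rewrite -(@esum_esum R nat nat setT (fun=> setT)
  (fun k j => (boxvol ((G k).1 j) ((G k).2 j))%:E)); last by move=> k j _ _; exact: (vol0 (k, j)).
rewrite -nneseries_esumT; last by move=> k; apply: esum_ge0 => j _; exact: (vol0 (k, j)).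
apply: lee_nneseries => k; first by move=> _ _; apply: esum_ge0 => j _; exact: (vol0 (k, j)).
by move=> _; rewrite -nneseries_esumT; [exact: (PG k).2|move=> j; exact: (vol0 (k, j))].
Qed.

HB.instance Definition _ (R : realType) (n : nat) :=
  isSubsetOuterMeasure.Build R 'rV[R]_n.+1 (@leb_outer R n.+1)
    (@leb_outer0 R n) (@leb_outer_ge0 R n.+1) (@leb_outer_sigma_subadditive R n.+1).

Lemma leb_nullS (R : realType) n (A B : set 'rV[R]_n.+1) :
  A `<=` B -> leb_null B -> leb_null A.
Proof.
rewrite /leb_null => AB B0; apply/eqP; rewrite eq_le leb_outer_ge0 andbT -B0.
exact: le_outer_measure.
Qed.

Lemma leb_null_bigcup (R : realType) n (A : nat -> set 'rV[R]_n.+1) :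
  (forall i, leb_null (A i)) -> leb_null (\bigcup_i A i).
Proof.
rewrite /leb_null => A0; apply/eqP; rewrite eq_le leb_outer_ge0 andbT.
apply: le_trans (outer_measure_sigma_subadditive (@leb_outer R n.+1) A) _.
by rewrite eseries0// => i _ _; exact: A0.
Qed.

Lemma leb_null_countable (R : realType) n (I : countType) (A : I -> set 'rV[R]_n.+1) :
  (forall i, leb_null (A i)) -> leb_null (\bigcup_i A i).
Proof.
move=> A0; pose B k := if unpickle k is Some i then A i else set0.
apply: (@leb_nullS _ _ _ (\bigcup_k B k)).
  by move=> x [i _ Aix]; exists (pickle i) => //; rewrite /B pickleK.
apply: leb_null_bigcup => k; rewrite /B; case: unpickle => //.
Qed.

(** * The sigma-algebra of boxes and Carathéodory measurability *)

Definition boxes (R : realType) n : set (set 'rV[R]_n) :=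
  [set E | exists a b, E = box a b].

Definition boxT (R : realType) n := g_sigma_algebraType (@boxes R n).

Lemma boxes_setI (R : realType) n : setI_closed (@boxes R n).
Proof.
move=> _ _ [a [b ->]] [c [d ->]].
exists (\row_i Num.max (a ord0 i) (c ord0 i)), (\row_i Num.min (b ord0 i) (d ord0 i)).
rewrite predeqE => x; split.
  move=> [xab xcd] i; rewrite !mxE ge_max le_min.
  have /andP[xa xb] := xab i; have /andP[xc xd] := xcd i.
  by apply/andP; split; apply/andP; split.
move=> xabcd; split=> i; have := xabcd i;
  by rewrite !mxE ge_max le_min => /andP[/andP[xa xc] /andP[xb xd]]; apply/andP; split.
Qed.

Lemma measurable_box (R : realType) n (a b : 'rV[R]_n) :
  measurable (box a b : set (boxT R n)).
Proof. by apply: sub_sigma_algebra; exists a, b. Qed.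

Definition setcoord (R : realType) n (v : 'rV[R]_n) (i : 'I_n) (s : R) : 'rV[R]_n :=
  \row_j if j == i then s else v ord0 j.

(** A box is cut by the hyperplane [x_i = t]. The truncation at 0 in [boxvol] covers empty boxes and
    hyperplanes that miss the box. *)
Lemma boxvol_split (R : realType) n (a b : 'rV[R]_n) i t :
  boxvol a (setcoord b i (Num.min (b ord0 i) t)) +
  boxvol (setcoord a i (Num.max (a ord0 i) t)) b = boxvol a b.
Proof.
rewrite /boxvol (bigD1 i)//= [X in _ + X](bigD1 i)//= [RHS](bigD1 i)//=.
rewrite !mxE eqxx.
have e1 s : \prod_(j < n | j != i) Num.max 0 (setcoord b i s ord0 j - a ord0 j) =
    \prod_(j < n | j != i) Num.max 0 (b ord0 j - a ord0 j).
  by apply: eq_bigr => j ji; rewrite !mxE (negbTE ji).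
have e2 s : \prod_(j < n | j != i) Num.max 0 (b ord0 j - setcoord a i s ord0 j) =
    \prod_(j < n | j != i) Num.max 0 (b ord0 j - a ord0 j).
  by apply: eq_bigr => j ji; rewrite !mxE (negbTE ji).
rewrite e1 e2 -mulrDl; congr (_ * _).
rewrite /Num.max /Num.min; repeat case: ifPn; rewrite -?leNgt; lra.
Qed.

(** Cutting each box of a cover along the hyperplane covers both parts with the same total volume.
    The two inclusions admit open and closed half-spaces alike. *)
Lemma halfspace_caratheodory (R : realType) n (E : set 'rV[R]_n.+1) i t :
  E `<=` [set x | x ord0 i <= t] -> ~` E `<=` [set x | t <= x ord0 i] ->
  (@leb_outer R n.+1).-caratheodory E.
Proof.
move=> El Er; apply: le_caratheodory_measurable => X.
apply: le_ereal_inf_tmp => _ [a [b [Xab ->]]].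
have L : (leb_outer (X `&` E) <= \sum_(0 <= j <oo)
    (boxvol (a j) (setcoord (b j) i (Num.min (b j ord0 i) t)))%:E)%E.
  apply: leb_outer_le => x [/Xab[j _ xj] /El/= xt]; exists j => // k.
  rewrite mxE; case: eqP => [->|_]; last exact: xj.
  by rewrite le_min xt andbT; exact: xj.
have U : (leb_outer (X `&` ~` E) <= \sum_(0 <= j <oo)
    (boxvol (setcoord (a j) i (Num.max (a j ord0 i) t)) (b j))%:E)%E.
  apply: leb_outer_le => x [/Xab[j _ xj] /Er/= xt]; exists j => // k.
  rewrite mxE; case: eqP => [->|_]; last exact: xj.
  by rewrite ge_max xt andbT; exact: xj.
apply: le_trans (leeD L U) _.
rewrite -nneseriesD; try by move=> *; rewrite lee_fin boxvol_ge0.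
rewrite le_eqVlt; apply/orP; left; apply/eqP.
by apply: eq_eseriesr => j _; rewrite -EFinD boxvol_split.
Qed.

Lemma box_caratheodory (R : realType) n (a b : 'rV[R]_n.+1) :
  (@leb_outer R n.+1).-caratheodory (box a b).
Proof.
pose U := caratheodory_type (@leb_outer R n.+1).
have -> : box a b = \bigcap_(i in [set: 'I_n.+1])
    ((~` [set x | x ord0 i < a ord0 i]) `&` [set x | x ord0 i <= b ord0 i]).
  rewrite predeqE => x; split.
    by move=> xab i _; have /andP[ax xb] := xab i; split => //=; apply/negP; rewrite -leNgt.
  by move=> xab i; have [/= /negP] := xab i I; rewrite -leNgt => -> ->.
apply: (@fin_bigcap_measurable _ U) => // i _.
apply: (@measurableI _ U); last first.
  by apply: (@halfspace_caratheodory _ _ _ i (b ord0 i)) => // x /= /negP; rewrite -ltNge => /ltW.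
apply: (@measurableC _ U).
apply: (@halfspace_caratheodory _ _ _ i (a ord0 i)) => x /=; first by move/ltW.
by move=> /negP; rewrite -leNgt.
Qed.

(** The Carathéodory measure is pushed forward by the identity, which is measurable because the
    Carathéodory sets form a sigma-algebra containing [G]. *)
Lemma outer_measure_restrict (R : realType) (T : pointedType)
    (mu : {outer_measure set T -> \bar R}) (G : set (set T)) :
  (forall A, G A -> mu.-caratheodory A) ->
  exists m : {measure set (g_sigma_algebraType G) -> \bar R}, forall A, m A = mu A.
Proof.
move=> Gmu.
have mid : measurable_fun setT (id : caratheodory_type mu -> g_sigma_algebraType G).
  move=> _ A mA; rewrite setTI; move: A mA; apply: smallest_sub.
    exact: (@sigma_algebra_measurable _ (caratheodory_type mu)).
  by move=> A; exact: Gmu.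
by exists (measure_function_pushforward__canonical__measure_function_Measure
  (mu : {measure set (caratheodory_type mu) -> \bar R}) mid).
Qed.

(** * Fubini for null sets *)

Lemma le_coord_norm (R : realType) n (x : 'rV[R]_n) i : `|x ord0 i| <= `|x|.
Proof.
rewrite [leRHS]/Num.norm /= mx_normrE; apply/bigmax_geP; right => /=.
by exists (ord0, i).
Qed.

Lemma norm_rV_le (R : realType) n (x : 'rV[R]_n) (e : R) :
  0 <= e -> (forall i, `|x ord0 i| <= e) -> `|x| <= e.
Proof.
move=> e0 xe; rewrite [leLHS]/Num.norm /= mx_normrE; apply/bigmax_leP; split => //.
by move=> [i j] _ /=; rewrite (ord1 i).
Qed.

(** Identifies R^n x R with R^(n+1), the real factor becoming coordinate [i]. *)
Definition inscoord (R : realType) n (i : 'I_n.+1) (p : boxT R n * measurableTypeR R) :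
    boxT R n.+1 :=
  \row_j (if unlift i j is Some k then (p.1 : 'rV[R]_n) ord0 k else p.2).

Lemma preimage_inscoord_box (R : realType) n (i : 'I_n.+1) (a b : 'rV[R]_n.+1) :
  @inscoord R n i @^-1` box a b =
  (box (col' i a) (col' i b) : set (boxT R n)) `*`
  (`[a ord0 i, b ord0 i]%classic : set (measurableTypeR R)).
Proof.
rewrite predeqE => -[x s]; split => /=.
  move=> H; split.
    by move=> k; have := H (lift i k); rewrite !mxE liftK.
  by have := H i; rewrite !mxE unlift_none /= in_itv.
move=> [xab sab] j; rewrite !mxE; case: unliftP => [k ->|->].
  by have := xab k; rewrite !mxE.
by move: sab; rewrite /= in_itv.
Qed.

Lemma measurable_inscoord (R : realType) n (i : 'I_n.+1) :
  measurable_fun setT (@inscoord R n i).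
Proof.
apply: (@measurability _ _ _ (boxT R n.+1) setT (@inscoord R n i) (@boxes R n.+1)) => //.
move=> _ [_ [a [b ->]] <-]; rewrite setTI preimage_inscoord_box.
by apply: measurableX; [exact: measurable_box|exact: measurable_itv].
Qed.

Lemma boxvol_inscoord (R : realType) n (i : 'I_n.+1) (a b : 'rV[R]_n.+1) :
  boxvol a b = boxvol (col' i a) (col' i b) * Num.max 0 (b ord0 i - a ord0 i).
Proof.
rewrite /boxvol (bigD1_ord i)//= mulrC; congr (_ * _).
by apply: eq_bigr => k _; rewrite !mxE.
Qed.

(** The product with one-dimensional Lebesgue measure, transported by [inscoord i]. The second
    conclusion keeps the product form, for Fubini along coordinate [i]. *)
Lemma box_measure_inscoord (R : realType) n (i : 'I_n.+1)
    (nu : {measure set (boxT R n) -> \bar R}) :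
  (forall a b, nu (box a b) = (boxvol a b)%:E) ->
  exists2 mu : {measure set (boxT R n.+1) -> \bar R},
    forall a b, mu (box a b) = (boxvol a b)%:E &
    forall A, mu A = (nu \x @lebesgue_measure R)%E (@inscoord R n i @^-1` A).
Proof.
move=> nuE; pose P : {measure set (boxT R n * measurableTypeR R) -> \bar R} :=
  (nu \x @lebesgue_measure R)%E.
have mf := @measurable_inscoord R n i.
pose mu : {measure set (boxT R n.+1) -> \bar R} :=
  measure_function_pushforward__canonical__measure_function_Measure P mf.
exists mu => // a b.
rewrite [LHS]/= /pushforward preimage_inscoord_box [LHS]product_measure1E//; last first.
  exact: measurable_box.
rewrite nuE (boxvol_inscoord i) EFinM; congr (_ * _)%E.
rewrite [LHS]lebesgue_measure_itv /= lte_fin.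
by case: ltP => [ab|ab]; [rewrite max_r ?subr_ge0 ?(ltW ab)|rewrite max_l ?subr_le0].
Qed.

Lemma box_measure_exists (R : realType) n :
  exists nu : {measure set (boxT R n) -> \bar R},
    forall a b, nu (box a b) = (boxvol a b)%:E.
Proof.
elim: n => [|n [nu nuE]]; last by have [mu muE _] := box_measure_inscoord ord0 nuE; exists mu.
(* In dimension 0 there is one point, and the empty product gives every box volume 1. *)
exists (\d_(0 : boxT R 0)) => a b.
rewrite [LHS]diracE /boxvol big_ord0.
by rewrite mem_set// => -[].
Qed.

Lemma leb_outer_unique (R : realType) n (mu : {measure set (boxT R n.+1) -> \bar R}) :
  (forall a b, mu (box a b) = (boxvol a b)%:E) ->
  forall A : set (boxT R n.+1), measurable A -> leb_outer A = mu A.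
Proof.
move=> muE A mA.
have [|L LE] := @outer_measure_restrict R 'rV[R]_n.+1 (@leb_outer R n.+1) (@boxes R n.+1).
  by move=> _ [a [b ->]]; exact: box_caratheodory.
pose g k : set (boxT R n.+1) := box (const_mx (- k%:R)) (const_mx k%:R).
(* That a box is not covered by boxes of smaller total volume is the sigma-subadditivity of [mu]. *)
have Lbox a b : L (box a b) = (boxvol a b)%:E.
  apply/eqP; rewrite LE eq_le leb_outer_box_le/= -muE.
  apply: le_ereal_inf_tmp => _ [c [d [Xcd ->]]].
  rewrite (eq_eseriesr (fun j _ => esym (muE (c j) (d j)))).
  by apply: measure_sigma_subadditive => // *; exact: measurable_box.
rewrite -LE.
apply: (@measure_unique _ R (boxT R n.+1) (@boxes R n.+1) g _ _ _ _ L mu _ _ A mA) => //.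
- exact: boxes_setI.
- by move=> k; do 2 eexists.
- rewrite -subTset => x _; exists (Num.bound `|x|) => // i.
  rewrite !mxE -ler_norml ltW// (le_lt_trans _ (unstable.ltr_bound _))//.
  exact: le_coord_norm.
- by move=> _ [a [b ->]]; rewrite Lbox muE.
- by move=> k; rewrite Lbox ltry.
Qed.

Lemma leb_null_sections (R : realType) n (i : 'I_n.+1) (A : set (boxT R n.+1)) :
  measurable A ->
  (forall x, lebesgue_measure (fun s => A (inscoord i (x, s))) = 0%E) ->
  leb_null A.
Proof.
move=> mA A0; have [nu nuE] := box_measure_exists R n.
have [mu muE muP] := box_measure_inscoord i nuE.
rewrite /leb_null (leb_outer_unique muE mA) muP /= /product_measure1.
apply: integral0_eq => x _ /=; rewrite -[RHS](A0 x); congr lebesgue_measure.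
by apply/funext => s; rewrite /xsection/= inE.
Qed.

(** * Partial derivatives *)

Lemma natSinv_lt (R : realType) (d : R) : 0 < d -> exists l : nat, l.+1%:R^-1 < d.
Proof.
move=> d0; exists (Num.bound d^-1); rewrite invf_plt ?posrE ?ltr0n//.
by rewrite (lt_le_trans (unstable.ltr_bound _))// ler_nat.
Qed.

Lemma measurable_countable_bigcup d (T : measurableType d) (I : countType)
    (F : I -> set T) :
  (forall i, measurable (F i)) -> measurable (\bigcup_i F i).
Proof. by move=> mF; apply: countable_bigcupT_measurable. Qed.

Lemma measurable_countable_bigcap d (T : measurableType d) (I : countType)
    (F : I -> set T) :
  (forall i, measurable (F i)) -> measurable (\bigcap_i F i).
Proof.
move=> mF; rewrite -[X in measurable X]setCK setC_bigcap; apply: measurableC.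
by apply: measurable_countable_bigcup => i; exact: measurableC.
Qed.

(** An open set is the countable union of the boxes with rational corners that it contains. *)
Lemma measurable_open_boxT (R : realType) n (U : set 'rV[R]_n) :
  (forall x, U x -> exists2 e, 0 < e & forall y, `|y - x| < e -> U y) ->
  measurable (U : set (boxT R n)).
Proof.
move=> oU.
pose rbox (pq : 'rV[rat]_n * 'rV[rat]_n) : set (boxT R n) :=
  box (map_mx ratr pq.1) (map_mx ratr pq.2).
have -> : U = \bigcup_pq [set x | rbox pq x /\ rbox pq `<=` U].
  rewrite predeqE => x; split; last by move=> [pq _ [xpq /(_ _ xpq)]].
  move=> Ux; have [e e0 eU] := oU x Ux.
  have /choice[p pP] : forall i, exists p : rat, ratr p \in `]x ord0 i - e / 2, x ord0 i[.
    by move=> i; apply: rat_in_itvoo; rewrite ltrBlDr ltrDl divr_gt0.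
  have /choice[q qP] : forall i, exists q : rat, ratr q \in `]x ord0 i, x ord0 i + e / 2[.
    by move=> i; apply: rat_in_itvoo; rewrite ltrDl divr_gt0.
  exists (\row_i p i, \row_i q i) => //; split.
    move=> i; rewrite !mxE; move: (pP i) (qP i); rewrite !in_itv/=.
    by move=> /andP[_ /ltW ->] /andP[/ltW -> _].
  move=> y yb; apply: eU; apply: (@le_lt_trans _ _ (e / 2)); last first.
    by rewrite ltr_pdivrMr// ltr_pMr// ltr1n.
  apply: norm_rV_le => [|i]; first by rewrite divr_ge0// ltW.
  have := yb i; rewrite !mxE; move: (pP i) (qP i); rewrite !in_itv/=.
  move=> /andP[? ?] /andP[? ?] /andP[? ?].
  by rewrite ler_norml; apply/andP; split; lra.
apply: measurable_countable_bigcup => pq.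
have [pqU|pqU] := pselect (rbox pq `<=` U).
  rewrite (_ : mkset _ = rbox pq); first exact: measurable_box.
  by rewrite predeqE => x; split => [[]|].
rewrite (_ : mkset _ = set0); first exact: measurable0.
by rewrite predeqE => x; split => [[]|].
Qed.

Lemma measurable_lipschitz_le (R : realType) n (G : 'rV[R]_n -> R) (L c : R) :
  (forall x y, `|G x - G y| <= L * `|x - y|) ->
  measurable ([set x | G x <= c] : set (boxT R n)).
Proof.
move=> GL; rewrite -[X in measurable X]setCK; apply: measurableC.
apply: measurable_open_boxT => x /= /negP; rewrite -ltNge => cG.
have L1 : 0 < `|L| + 1 by rewrite ltr_wpDl.
exists ((G x - c) / (`|L| + 1)); first by apply: divr_gt0; rewrite // subr_gt0.
move=> y; rewrite ltr_pdivlMr// => yx; apply/negP; rewrite -ltNge.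
have h := GL y x.
have h2 : L * `|y - x| <= `|y - x| * (`|L| + 1).
  by rewrite mulrDr mulr1 mulrC ler_wpDr// ler_wpM2l// ler_norm.
by move: h; rewrite ler_norml => /andP[h _]; lra.
Qed.

Definition basisv (R : realType) n (i : 'I_n) : 'rV[R]_n := delta_mx ord0 i.

Lemma norm_basisv (R : realType) n (i : 'I_n) (s : R) : `|s *: basisv R i| = `|s|.
Proof.
apply/eqP; rewrite eq_le; apply/andP; split.
  apply: norm_rV_le => // j; rewrite /basisv !mxE eqxx/=.
  by case: eqP => _; rewrite ?mulr1// mulr0 normr0.
by apply: le_trans (le_coord_norm _ i); rewrite /basisv !mxE !eqxx mulr1.
Qed.

(* The slope [a] is allowed to depend on the precision [e]; this is equivalent
   to the existence of the partial derivative, and avoids taking limits. *)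
Definition pdiff (R : realType) n (F : 'rV[R]_n -> R) (i : 'I_n) (x : 'rV[R]_n) :=
  forall e, 0 < e -> exists a d, 0 < d /\
    forall s, `|s| < d -> `|F (x + s *: basisv R i) - F x - a * s| <= e * `|s|.

Lemma inscoord_shift (R : realType) n (i : 'I_n.+1) (x : boxT R n) (s t : R) :
  (inscoord i (x, t) : 'rV[R]_n.+1) + s *: basisv R i = inscoord i (x, t + s).
Proof.
apply/rowP => j; rewrite /inscoord /basisv !mxE/=. case: unliftP => [k ->|->].
  by rewrite eq_sym (negbTE (neq_lift _ _)) mulr0 addr0.
by rewrite eqxx mulr1.
Qed.

(** On each line parallel to axis [i] this is the one-variable theorem. Fubini asks for a measurable
    set, so [good] expresses [pdiff] by countable operations, with rational slopes and
    increments. *)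
Lemma lipschitz_pdiff_ae (R : realType) n (F : 'rV[R]_n.+1 -> R) (L : R) (i : 'I_n.+1) :
  (forall x y, `|F x - F y| <= L * `|x - y|) ->
  leb_null [set x | ~ pdiff F i x].
Proof.
move=> FL.
pose D (q s : rat) x := F (x + ratr s *: basisv R i) - F x - ratr q * ratr s.
pose good : set (boxT R n.+1) := \bigcap_(m : nat) \bigcup_(ql : rat * nat)
  \bigcap_(s : rat) [set x | `|ratr s : R| < ql.2.+1%:R^-1 ->
    `|D ql.1 s x| <= m.+1%:R^-1 * `|ratr s|].
have L0 : 0 <= L.
  have := le_trans (normr_ge0 _) (FL (basisv R i) 0); rewrite subr0.
  by rewrite -[basisv R i]scale1r norm_basisv normr1 mulr1.
have mgood : measurable good.
  apply: measurable_countable_bigcap => m; apply: measurable_countable_bigcup => -[q l].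
  apply: measurable_countable_bigcap => s /=.
  have [sl|sl] := boolP (`|ratr s : R| < l.+1%:R^-1); last first.
    rewrite (_ : mkset _ = setT); first exact: measurableT.
    by rewrite predeqE => x; split.
  rewrite (_ : mkset _ = [set x | `|D q s x| <= m.+1%:R^-1 * `|ratr s|]); last first.
    by rewrite predeqE => x; split => /= [/(_ isT)|h _].
  apply: (@measurable_lipschitz_le _ _ _ (L + L)) => x y.
  apply: (le_trans (ler_dist_dist _ _)).
  have -> : D q s x - D q s y = (F (x + ratr s *: basisv R i) - F (y + ratr s *: basisv R i))
     - (F x - F y) by rewrite /D; ring.
  apply: (le_trans (ler_normB _ _)); rewrite mulrDl lerD//.
  by apply: le_trans (FL _ _) _; rewrite opprD addrACA subrr addr0.
apply: (@leb_nullS _ _ _ (~` good)); last first.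
  apply: (@leb_null_sections _ _ i); first exact: measurableC.
  move=> x; pose g (t : R) := F (inscoord i (x, t)).
  have gL s t : `|g s - g t| <= (L + 1) * `|s - t|.
    apply: (le_trans (FL _ _)).
    have -> : inscoord i (x, s) - inscoord i (x, t) = (s - t) *: basisv R i :> 'rV[R]_n.+1.
      by rewrite -[s in LHS](subrKC t) -inscoord_shift addrC addKr.
    by rewrite norm_basisv ler_wpM2r// lerDl.
  have [|N [mN N0] NP] := lipschitz_ae_difference_quotient _ gL.
    by rewrite ltr_wpDl.
  have mS : measurable ((fun s => (~` good) (inscoord i (x, s))) : set (measurableTypeR R)).
    have := @measurable_inscoord R n i measurableT _ (measurableC mgood).
    rewrite setTI => /(measurable_xsection x).
    by rewrite /xsection; under eq_fun do rewrite inE.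
  apply/eqP; rewrite eq_le measure_ge0 andbT -N0 le_measure ?inE// => t /=.
  apply: contra_notP => Nt m _.
  have [a aP] := NP t Nt.
  have m0 : (0 : R) < m.+1%:R^-1 / 2 by rewrite divr_gt0// invr_gt0 ltr0n.
  have [d d0 dP] := aP _ m0; have [l ld] := natSinv_lt d0.
  (* Half of the precision pays for replacing the slope [a] by a rational one. *)
  have [q qa] : exists q : rat, ratr q \in `]a, a + m.+1%:R^-1 / 2[.
    by apply: rat_in_itvoo; rewrite ltrDl.
  exists (q, l) => // s _ /= sl; rewrite /D inscoord_shift.
  have := dP (ratr s) (lt_trans sl ld); rewrite -/(g t) -/(g (t + ratr s)) => h.
  have -> : g (t + ratr s) - g t - ratr q * ratr s =
    (g (t + ratr s) - g t - a * ratr s) + (a - ratr q) * ratr s by ring.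
  apply: (le_trans (ler_normD _ _)); rewrite [leRHS](_ : _ =
    m.+1%:R^-1 / 2 * `|ratr s| + m.+1%:R^-1 / 2 * `|ratr s|); last by field.
  rewrite lerD// normrM ler_wpM2r//; move: qa m0; rewrite in_itv/=.
  move: (m.+1%:R^-1 / 2) (ratr q) => r u /andP[ua ur] r0.
  by rewrite ler_norml; apply/andP; split; lra.
move=> x /=; apply: contra_not => gx e e0.
have [m me] := natSinv_lt e0; have [[q l] _ ql] := gx m I.
exists (ratr q), l.+1%:R^-1; split; first by rewrite invr_gt0 ltr0n.
move=> s sl; rewrite leNgt; apply/negP => abs.
have [s0|s0] := eqVneq s 0.
  by move: abs; rewrite s0 scale0r addr0 subrr mulr0 subrr normr0 mulr0 ltxx.
(* [E] is the supposed excess at the real increment [s]. Moving to a rational [p] costs at most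
   [C * |p - s| < E], contradicting the estimate at [p]; the second bound in [r] keeps [p] in the
   admissible range. *)
pose E := `|F (x + s *: basisv R i) - F x - ratr q * s| - e * `|s|.
pose C := L + `|ratr q| + e.
have C0 : 0 < C by rewrite ltr_wpDl// addr_ge0.
pose r := Num.min (E / C) (l.+1%:R^-1 - `|s|).
have r0 : 0 < r by rewrite lt_min subr_gt0 sl divr_gt0// subr_gt0.
have [p] := @rat_in_itvoo _ s (s + r) (ltac:(by rewrite ltrDl)).
rewrite in_itv/= => /andP[sp pr].
have ps : `|ratr p - s| < r by rewrite gtr0_norm ?subr_gt0//; lra.
have pl : `|ratr p : R| < l.+1%:R^-1.
  rewrite -(subrK s (ratr p)); apply: (le_lt_trans (ler_normD _ _)).
  by rewrite -ltrBrDr (lt_le_trans ps)// ge_min lexx orbT.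
have := ql p I; rewrite /= => /(_ pl); rewrite /D => h.
have h1 : `|F (x + s *: basisv R i) - F (x + ratr p *: basisv R i)| <= L * `|ratr p - s|.
  apply: (le_trans (FL _ _)).
  by rewrite opprD addrACA subrr add0r -scalerBl norm_basisv distrC.
have h2 : m.+1%:R^-1 * `|ratr p : R| <= e * `|s| + e * `|ratr p - s|.
  rewrite -mulrDr; apply: ler_pM => //; first exact: ltW.
  by rewrite -[X in `|X| <= _](subrK s) addrC; apply: le_trans (ler_normD _ _) _; rewrite addrC.
have h3 : `|ratr q * (ratr p - s)| <= `|ratr q| * `|ratr p - s| by rewrite normrM.
have h4 : C * `|ratr p - s| < E.
  by rewrite mulrC -ltr_pdivlMr// (lt_le_trans ps)// ge_min lexx.
have : `|F (x + s *: basisv R i) - F x - ratr q * s| <=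
   `|F (x + s *: basisv R i) - F (x + ratr p *: basisv R i)| +
   `|F (x + ratr p *: basisv R i) - F x - ratr q * ratr p| + `|ratr q * (ratr p - s)|.
  rewrite [in leLHS](_ : _ - ratr q * s =
    (F (x + s *: basisv R i) - F (x + ratr p *: basisv R i)) +
    (F (x + ratr p *: basisv R i) - F x - ratr q * ratr p) + ratr q * (ratr p - s)).
    by apply: (le_trans (ler_normD _ _)); rewrite lerD2r ler_normD.
  by ring.
have h5 := le_trans h h2.
move: h4 h5 h1 h3; rewrite /C /E 2!mulrDl; clear.
move: (`|_ - ratr q * s|) (L * _) (`|ratr q| * _) (e * `|ratr p - s|) (e * `|s|).
move: (`|F (x + s *: _) - _|) (`|_ - ratr q * ratr p|) (`|ratr q * _|) => *.
lra.
Qed.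

(** * Approaching a set from outside *)

(** For [g] Lipschitz on [S] with constant [L], the largest [L]-Lipschitz extension. With [g = 0]
    and [L = 1] it is the sup-norm distance to [S]. *)
Definition mcshane (R : realType) n (S : set 'rV[R]_n) (g : 'rV[R]_n -> R) (L : R)
    (x : 'rV[R]_n) : R :=
  inf [set g z + L * `|x - z| | z in S].

(** Labels that coincide on a whole piece thus get the same extension, hence later the same
    matrix. *)
Lemma eq_mcshane (R : realType) n (S : set 'rV[R]_n) (g g' : 'rV[R]_n -> R) (L : R) :
  (forall z, S z -> g z = g' z) -> mcshane S g L = mcshane S g' L.
Proof.
move=> gg'; apply/funext => x; rewrite /mcshane; congr inf.
by apply: eq_imagel => z Sz; rewrite gg'.
Qed.

Section mcshane_extension.
Context (R : realType) (n : nat) (S : set 'rV[R]_n) (g : 'rV[R]_n -> R) (L : R).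
Hypotheses (L0 : 0 <= L)
  (gL : forall z w, S z -> S w -> `|g z - g w| <= L * `|z - w|).

Let mcshane_lb x w : S w -> lbound [set g z + L * `|x - z| | z in S] (g w - L * `|x - w|).
Proof.
move=> Sw _ [z Sz <-]; have := gL Sz Sw; rewrite ler_norml => /andP[h _].
have : L * `|z - w| <= L * `|x - z| + L * `|x - w|.
  by rewrite -mulrDr ler_wpM2l// (distrC x z) ler_distD.
by lra.
Qed.

Lemma mcshane_le x z : S z -> mcshane S g L x <= g z + L * `|x - z|.
Proof.
move=> Sz; apply: ge_inf; last by exists z.
by exists (g z - L * `|x - z|); exact: mcshane_lb.
Qed.

Lemma mcshane_ge x w : S w -> g w - L * `|x - w| <= mcshane S g L x.
Proof.
move=> Sw; apply: lb_le_inf; last exact: mcshane_lb.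
by exists (g w + L * `|x - w|), w.
Qed.

Lemma mcshane_id x : S x -> mcshane S g L x = g x.
Proof.
move=> Sx; apply/eqP; rewrite eq_le; apply/andP; split.
  by have := mcshane_le x Sx; rewrite subrr normr0 mulr0 addr0.
by have := mcshane_ge x Sx; rewrite subrr normr0 mulr0 subr0.
Qed.

Lemma mcshane_lt x c : S !=set0 -> mcshane S g L x < c ->
  exists2 z, S z & g z + L * `|x - z| < c.
Proof.
move=> [w Sw] /inf_lt[|_ [z Sz <-] zc]; last by exists z.
by exists (g w + L * `|x - w|), w.
Qed.

Lemma mcshane_lipschitz x y : S !=set0 ->
  `|mcshane S g L x - mcshane S g L y| <= L * `|x - y|.
Proof.
move=> S0.
have H u v : mcshane S g L u <= mcshane S g L v + L * `|u - v|.
  apply/ler_addgt0Pr => e e0.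
  have [z Sz zP] : exists2 z, S z & g z + L * `|v - z| < mcshane S g L v + e.
    by apply: mcshane_lt => //; rewrite ltrDl.
  apply: (le_trans (mcshane_le u Sz)).
  have : L * `|u - z| <= L * `|u - v| + L * `|v - z|.
    by rewrite -mulrDr ler_wpM2l// ler_distD.
  by lra.
by rewrite ler_norml; have := H x y; have := H y x; rewrite (distrC y x) => ? ?;
  apply/andP; split; lra.
Qed.

End mcshane_extension.

(** This is dist(x + h, S) = o(|h|) for [h] in [V], phrased with a witness in [S]. *)
Definition approachable (R : realType) n (S V : set 'rV[R]_n) (x : 'rV[R]_n) :=
  forall e, 0 < e -> exists2 d, 0 < d &
    forall h, V h -> `|h| < d -> exists2 z, S z & `|z - (x + h)| <= e * `|h|.

(* The distance to [S] vanishes on [S], hence so do its partial derivatives. *)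
Lemma approachable_axis_ae (R : realType) n (S : set 'rV[R]_n.+1) (i : 'I_n.+1) :
  leb_null [set x | S x /\ ~ approachable S [set s *: basisv R i | s in setT] x].
Proof.
have [->|/set0P S0] := eqVneq S set0.
  by rewrite (_ : mkset _ = set0) ?/leb_null ?leb_outer0// -subset0 => x [].
pose dist := mcshane S (fun=> 0) 1.
have cst0 (z w : 'rV[R]_n.+1) : S z -> S w -> `|(0 : R) - 0| <= 1 * `|z - w|.
  by move=> _ _; rewrite subrr normr0 mul1r.
have dist0 x : 0 <= dist x.
  have [w Sw] := S0; apply: lb_le_inf; first by exists (0 + 1 * `|x - w|), w.
  by move=> _ [z _ <-]; rewrite add0r mul1r.
apply: (leb_nullS _ (@lipschitz_pdiff_ae R n dist 1 i _)); last first.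
  by move=> x y; exact: (mcshane_lipschitz ler01 cst0).
move=> x [Sx]; apply: contra_not => dx e e0.
have e4 : 0 < e / 4 by rewrite divr_gt0.
have [a [d [d0 dP]]] := dx _ e4; exists d => // _ [s _ <-]; rewrite norm_basisv => sd.
have [->|s0] := eqVneq s 0.
  by exists x => //; rewrite scale0r addr0 subrr !normr0 mulr0.
have s0' : 0 < `|s| by rewrite normr_gt0.
have distx : dist x = 0 by exact: (mcshane_id ler01 cst0).
have [|z Sz zP] := @mcshane_lt R _ S (fun=> 0) 1
    (x + s *: basisv R i) (e * `|s|) S0; last first.
  by exists z => //; move: zP; rewrite add0r mul1r distrC => /ltW.
have := dP s sd; have := dP (- s); rewrite normrN => /(_ sd).
(* Adding the estimates at [s] and [-s] cancels the slope [a]; as the distance at [x - s e_i] is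
   nonnegative, the one at [x + s e_i] is at most [e |s| / 2]. *)
rewrite -/dist distx !ler_norml => /andP[_ h1] /andP[_ h2].
have h3 := dist0 (x + - s *: basisv R i).
have : 0 < e * `|s| by rewrite mulr_gt0.
move: h1 h2 h3; rewrite mulrN (_ : e / 4 * `|s| = e * `|s| / 4); last by ring.
by move: (e * `|s|) (a * s) => u v; lra.
Qed.

Definition prefixv (R : realType) n (j : nat) : set 'rV[R]_n :=
  [set h | forall c : 'I_n, (j <= c)%N -> h ord0 c = 0].

(** Induction on the number of coordinates. [T (l, m)] collects the points of [S] with precision
    1/(l+1) up to radius 1/(m+1) along the first [j] axes. From [x], a move along axis [j] ends near
    a point of [T (l, m)], whose uniform estimate handles the remaining displacement. *)
Lemma approachable_prefix_ae (R : realType) n (j : nat) (S : set 'rV[R]_n.+1) :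
  leb_null [set x | S x /\ ~ approachable S (@prefixv R n.+1 j) x].
Proof.
elim: j S => [|j IH] S.
  rewrite (_ : mkset _ = set0) ?/leb_null ?leb_outer0// -subset0 => x [Sx]; apply.
  move=> e e0; exists 1 => // h h0 _; exists x => //.
  by rewrite (_ : h = 0) ?addr0 ?subrr ?normr0 ?mulr0//; apply/rowP => c; rewrite h0// mxE.
have [jn|nj] := ltnP j n.+1; last first.
  apply: leb_nullS (IH S) => x [Sx nx]; split => //; apply: contra_not nx => ax e e0.
  have [d d0 dP] := ax e e0; exists d => // h _; apply: dP => c jc.
  by have := leq_trans nj jc; rewrite leqNgt ltn_ord.
pose i := Ordinal jn.
pose T (lm : nat * nat) := [set x | S x /\ forall h, @prefixv R n.+1 j h ->
  `|h| < lm.2.+1%:R^-1 -> exists2 z, S z & `|z - (x + h)| <= lm.1.+1%:R^-1 * `|h|].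
pose bad (o : option (nat * nat)) := match o with
  | None => [set x | S x /\ ~ approachable S (@prefixv R n.+1 j) x]
  | Some lm => [set x | T lm x /\
      ~ approachable (T lm) [set s *: basisv R i | s in setT] x] end.
have : leb_null (\bigcup_o bad o).
  by apply: leb_null_countable => -[lm|]; [exact: approachable_axis_ae|exact: IH].
apply: leb_nullS => x [Sx]; apply: contra_notP => nbad.
have aS : approachable S (@prefixv R n.+1 j) x.
  by apply: contrapT => na; apply: nbad; exists None.
move=> e e0; have e2 : 0 < e / 2 by rewrite divr_gt0.
have [l le] := natSinv_lt e2.
have l0 : (0 : R) < l.+1%:R^-1 by rewrite invr_gt0 ltr0n.
have [d d0 dP] := aS _ l0; have [m md] := natSinv_lt d0.
have Tx : T (l, m) x.
  by split => // h jh hm; apply: dP => //; exact: lt_trans md.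
have aT : approachable (T (l, m)) [set s *: basisv R i | s in setT] x.
  by apply: contrapT => na; apply: nbad; exists (Some (l, m)).
have [d' d'0 d'P] := aT _ e2.
exists (Num.min d' m.+1%:R^-1); first by rewrite lt_min d'0 invr_gt0 ltr0n.
move=> h jh; rewrite lt_min => /andP[hd' hm].
set t := h ord0 i; set h' := h - t *: basisv R i.
have th : `|t| <= `|h| by exact: le_coord_norm.
have h'E c : h' ord0 c = if c == i then 0 else h ord0 c.
  rewrite /h' /basisv !mxE/= /t; case: eqP => [->|_]; first by rewrite mulr1 subrr.
  by rewrite mulr0 subr0.
have h'h : `|h'| <= `|h|.
  apply: norm_rV_le => // c; rewrite h'E; case: eqP => _; first by rewrite normr0.
  exact: le_coord_norm.
have jh' : @prefixv R n.+1 j h'.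
  move=> c; rewrite h'E leq_eqVlt => /orP[/eqP jc|jc].
    by rewrite (_ : c == i) //; apply/eqP/val_inj.
  by case: eqP => // _; exact: jh.
have [||y [Sy Ty] xy] := d'P (t *: basisv R i).
- by exists t.
- by rewrite norm_basisv (le_lt_trans th).
have [z Sz yz] := Ty h' jh' (le_lt_trans h'h hm).
exists z => //.
have -> : z - (x + h) = (z - (y + h')) + (y - (x + t *: basisv R i)).
  by rewrite /h'; apply/rowP => c; rewrite !mxE; ring.
apply: (le_trans (ler_normD _ _)).
rewrite [leRHS](_ : _ = e / 2 * `|h| + e / 2 * `|h|); last by field.
rewrite lerD//; first by apply: (le_trans yz); rewrite ler_pM// ltW.
apply: (le_trans xy); rewrite norm_basisv ler_wpM2l//; exact: ltW.
Qed.

Lemma approachable_ae (R : realType) n (S : set 'rV[R]_n.+1) :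
  leb_null [set x | S x /\ ~ approachable S setT x].
Proof.
apply: leb_nullS (approachable_prefix_ae n.+1 S) => x [Sx nx]; split => //.
apply: contra_not nx => ax e e0; have [d d0 dP] := ax e e0.
by exists d => // h _; apply: dP => c; rewrite leqNgt ltn_ord.
Qed.

(** * Rademacher's theorem *)

Definition dot (R : realType) n (a h : 'rV[R]_n) : R := \sum_c a ord0 c * h ord0 c.

Lemma dotDr (R : realType) n (a u v : 'rV[R]_n) : dot a (u + v) = dot a u + dot a v.
Proof. by rewrite /dot -big_split; apply: eq_bigr => c _; rewrite mxE mulrDr. Qed.

Lemma dot_basisv (R : realType) n (a : 'rV[R]_n) s i :
  dot a (s *: basisv R i) = a ord0 i * s.
Proof.
rewrite /dot (bigD1 i)//= big1 ?addr0 => [|c ci]; rewrite /basisv !mxE/=.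
  by rewrite eqxx mulr1.
by rewrite (negbTE ci) !mulr0.
Qed.

Definition linear_approx (R : realType) n (F : 'rV[R]_n -> R) (x a : 'rV[R]_n) (e : R) :=
  exists2 d, 0 < d & forall h, `|h| < d -> `|F (x + h) - F x - dot a h| <= e * `|h|.

Definition trunc_row (R : realType) n (j : nat) (h : 'rV[R]_n) : 'rV[R]_n :=
  \row_c if (c < j)%N then h ord0 c else 0.

Lemma norm_trunc_row (R : realType) n j (h : 'rV[R]_n) : `|trunc_row j h| <= `|h|.
Proof.
apply: norm_rV_le => // c; rewrite mxE; case: ifP => _; first exact: le_coord_norm.
by rewrite normr0.
Qed.

(* [x + h] is reached from [x] by moving along one coordinate at a time; each
   corner is close to a point of [E], from which the step is almost linear. *)
Lemma approachable_linear_approx (R : realType) n (F : 'rV[R]_n -> R) (L e d : R)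
    (a : 'rV[R]_n) (E : set 'rV[R]_n) (x : 'rV[R]_n) :
  (forall x y, `|F x - F y| <= L * `|x - y|) -> 0 <= L -> 0 < e -> 0 < d ->
  (forall y i s, E y -> `|s| < d ->
    `|F (y + s *: basisv R i) - F y - a ord0 i * s| <= e * `|s|) ->
  approachable E setT x ->
  linear_approx F x a (n%:R * (e + (L + L) * e)).
Proof.
move=> FL L0 e0 d0 EF Ex; have [r r0 rP] := Ex e e0.
exists (Num.min r d); first by rewrite lt_min r0.
move=> h; rewrite lt_min => /andP[hr hd].
(* Each coordinate step costs [e] for the slope at [y], and [L * e] twice for exchanging [y] with
   the corner before and after the step. *)
have H j : (j <= n)%N ->
  `|F (x + trunc_row j h) - F x - dot a (trunc_row j h)| <=
    j%:R * (e + (L + L) * e) * `|h|.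
  elim: j => [_|j IH jn].
    have -> : trunc_row 0 h = 0 by apply/rowP => c; rewrite !mxE ltn0.
    rewrite addr0 subrr /dot big1 ?subrr ?normr0 ?mul0r// => c _.
    by rewrite mxE mulr0.
  pose i := Ordinal jn; pose t := h ord0 i; set u := trunc_row j h.
  have -> : trunc_row j.+1 h = u + t *: basisv R i.
    apply/rowP => c; rewrite /basisv !mxE ltnS leq_eqVlt /=.
    have [->|ci] := eqVneq c i; first by rewrite eqxx ltnn add0r mulr1.
    by rewrite (_ : (c == j :> nat) = false) ?mulr0 ?addr0//; apply/negbTE.
  have th : `|t| <= `|h| by exact: le_coord_norm.
  have uh : `|u| <= `|h| by exact: norm_trunc_row.
  have [y Ey yu] := rP u I (le_lt_trans uh hr).
  have yh : `|y - (x + u)| <= e * `|h|.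
    by apply: (le_trans yu); rewrite ler_wpM2l// ltW.
  have h1 : `|F (x + u + t *: basisv R i) - F (y + t *: basisv R i)| <= L * (e * `|h|).
    apply: (le_trans (FL _ _)); rewrite opprD addrACA subrr addr0 distrC.
    by rewrite ler_wpM2l.
  have h2 : `|F y - F (x + u)| <= L * (e * `|h|).
    by apply: (le_trans (FL _ _)); rewrite ler_wpM2l.
  have h3 : `|F (y + t *: basisv R i) - F y - a ord0 i * t| <= e * `|h|.
    apply: (le_trans (EF y i t Ey (le_lt_trans th hd))).
    by rewrite ler_wpM2l// ltW.
  rewrite dotDr dot_basisv addrA.
  rewrite [X in `|X| <= _](_ : _ = (F (x + u) - F x - dot a u) +
      (F (x + u + t *: basisv R i) - F (y + t *: basisv R i)) +
      (F (y + t *: basisv R i) - F y - a ord0 i * t) + (F y - F (x + u))); last by ring.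
  have -> : j.+1%:R * (e + (L + L) * e) * `|h| =
    j%:R * (e + (L + L) * e) * `|h| + L * (e * `|h|) + e * `|h| + L * (e * `|h|).
    by rewrite -natr1; ring.
  apply: (le_trans (ler_normD _ _)); rewrite lerD//.
  apply: (le_trans (ler_normD _ _)); rewrite lerD//.
  by apply: (le_trans (ler_normD _ _)); rewrite lerD// IH// ltnW.
by have := H n (leqnn n); rewrite (_ : trunc_row n h = h)//;
  apply/rowP => c; rewrite mxE ltn_ord.
Qed.

(** [E p] fixes rational slopes, a precision and a radius, so there are countably many. Almost every
    [x] has all its partial derivatives and is approachable from each [E p] containing it. The
    vector [a] may still depend on [e]. *)
Lemma linear_approx_ae (R : realType) n (F : 'rV[R]_n.+1 -> R) (L : R) :
  (forall x y, `|F x - F y| <= L * `|x - y|) ->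
  leb_null [set x | ~ forall e, 0 < e -> exists a, linear_approx F x a e].
Proof.
move=> FL.
have L0 : 0 <= L.
  have := le_trans (normr_ge0 _) (FL (basisv R ord0) 0); rewrite subr0.
  by rewrite -[basisv R _]scale1r norm_basisv normr1 mulr1.
pose E (p : 'rV[rat]_n.+1 * nat * nat) := [set x | forall i s,
  `|s| < p.2.+1%:R^-1 ->
  `|F (x + s *: basisv R i) - F x - (map_mx ratr p.1.1) ord0 i * s| <= p.1.2.+1%:R^-1 * `|s|].
pose bad (o : 'I_n.+1 + 'rV[rat]_n.+1 * nat * nat) := match o with
  | inl i => [set x | ~ pdiff F i x]
  | inr p => [set x | E p x /\ ~ approachable (E p) setT x] end.
have : leb_null (\bigcup_o bad o).
  apply: leb_null_countable => -[i|p]; last exact: approachable_ae.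
  exact: lipschitz_pdiff_ae FL.
apply: leb_nullS => x /=; apply: contra_notP => nbad e e0.
have px i : pdiff F i x by apply: contrapT => np; apply: nbad; exists (inl i).
(* The error factor of [approachable_linear_approx] is [C] times the precision. *)
pose C := n.+1%:R * (1 + (L + L)).
have C0 : 0 < C by rewrite mulr_gt0 ?ltr0n// ltr_wpDr// addr_ge0.
have eC : 0 < e / C by rewrite divr_gt0.
have [l le] := natSinv_lt eC.
have l0 : (0 : R) < l.+1%:R^-1 by rewrite invr_gt0 ltr0n.
have /choice[qm qmP] : forall i, exists qm : rat * nat, forall s, `|s| < qm.2.+1%:R^-1 ->
    `|F (x + s *: basisv R i) - F x - ratr qm.1 * s| <= l.+1%:R^-1 * `|s|.
  move=> i; have l2 : (0 : R) < l.+1%:R^-1 / 2 by rewrite divr_gt0.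
  have [b [d [d0 dP]]] := px i _ l2; have [m md] := natSinv_lt d0.
  have [q qb] : exists q : rat, ratr q \in `]b, b + l.+1%:R^-1 / 2[.
    by apply: rat_in_itvoo; rewrite ltrDl.
  exists (q, m) => s /= sm; have := dP s (lt_trans sm md) => h.
  rewrite [X in `|X| <= _](_ : _ = (F (x + s *: basisv R i) - F x - b * s)
    + (b - ratr q) * s); last by ring.
  rewrite [leRHS](_ : _ = l.+1%:R^-1 / 2 * `|s| + l.+1%:R^-1 / 2 * `|s|); last by field.
  apply: (le_trans (ler_normD _ _)); rewrite lerD// normrM ler_wpM2r//.
  move: qb l2; rewrite in_itv/=; move: (l.+1%:R^-1 / 2) (ratr q) => r u /andP[ua ur] _.
  by rewrite ler_norml; apply/andP; split; lra.
(* The largest index gives a radius valid for all coordinates at once. *)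
pose m := \max_i (qm i).2.
pose p := ((\row_i (qm i).1, l), m).
have Ep : E p x.
  move=> i s /= sm; rewrite !mxE; apply: qmP; apply: (lt_le_trans sm).
  by rewrite lef_pV2 ?posrE ?ltr0n// ler_nat ltnS; exact: leq_bigmax.
have Ax : approachable (E p) setT x.
  by apply: contrapT => na; apply: nbad; exists (inr p).
exists (map_mx ratr p.1.1).
have m0 : (0 : R) < m.+1%:R^-1 by rewrite invr_gt0 ltr0n.
have [d d0 dP] := @approachable_linear_approx _ _ F L l.+1%:R^-1 m.+1%:R^-1
  (map_mx ratr p.1.1) (E p) x FL L0 l0 m0 (fun y i s Ey => Ey i s) Ax.
exists d => // h hd; apply: (le_trans (dP h hd)); rewrite ler_wpM2r//.
rewrite [leLHS](_ : _ = C * l.+1%:R^-1); last by rewrite /C; ring.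
by rewrite mulrC -ler_pdivlMr// ltW.
Qed.

Definition is_gradient (R : realType) n (F : 'rV[R]_n -> R) (x a : 'rV[R]_n) :=
  forall e, 0 < e -> linear_approx F x a e.

(** Evaluating along the axes shows that the intervals of radius 1/(m+1) around [b m ord0 i] meet
    pairwise; the infimum of their right ends lies in all of them. *)
Lemma gradient_exists (R : realType) n (F : 'rV[R]_n -> R) (x : 'rV[R]_n) :
  (forall e, 0 < e -> exists a, linear_approx F x a e) -> exists a, is_gradient F x a.
Proof.
move=> Fx.
have /choice[b bP] : forall m : nat, exists a, linear_approx F x a m.+1%:R^-1.
  by move=> m; apply: Fx; rewrite invr_gt0 ltr0n.
have bb m m' i : b m ord0 i - m.+1%:R^-1 <= b m' ord0 i + m'.+1%:R^-1.
  have [d d0 dP] := bP m; have [d' d'0 d'P] := bP m'.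
  pose s := Num.min d d' / 2.
  have s0 : 0 < s by rewrite divr_gt0// lt_min d0.
  have sd : `|s *: basisv R i| < d.
    by rewrite norm_basisv gtr0_norm// ltr_pdivrMr// (@le_lt_trans _ _ d)
      ?ge_min ?lexx// ltr_pMr// ltr1n.
  have sd' : `|s *: basisv R i| < d'.
    by rewrite norm_basisv gtr0_norm// ltr_pdivrMr// (@le_lt_trans _ _ d')
      ?ge_min ?lexx ?orbT// ltr_pMr// ltr1n.
  have := dP _ sd; have := d'P _ sd'; rewrite !dot_basisv norm_basisv (gtr0_norm s0).
  rewrite !ler_norml => /andP[_ h1] /andP[h2 _].
  rewrite -(ler_pM2r s0) [leRHS]mulrDl [leLHS]mulrBl.
  move: h1 h2; move: (m.+1%:R^-1 * s) (m'.+1%:R^-1 * s) (b m ord0 i * s) (b m' ord0 i * s).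
  by move=> *; lra.
pose a := \row_i inf [set b m ord0 i + m.+1%:R^-1 | m in setT].
exists a => e e0.
(* The 1 pays for the approximation by [b m], and [n] for replacing [b m] by [a] in each
   coordinate. *)
have [m me] : exists m : nat, m.+1%:R^-1 < e / (1 + n%:R).
  by apply: natSinv_lt; rewrite divr_gt0// ltr_wpDr.
have ab i : `|b m ord0 i - a ord0 i| <= m.+1%:R^-1.
  have h1 : a ord0 i <= b m ord0 i + m.+1%:R^-1.
    rewrite mxE; apply: ge_inf; last by exists m.
    by exists (b 0%N ord0 i - 1%:R^-1) => _ [m' _ <-]; exact: bb.
  have h2 : b m ord0 i - m.+1%:R^-1 <= a ord0 i.
    rewrite mxE; apply: lb_le_inf; first by exists (b m ord0 i + m.+1%:R^-1), m.
    by move=> _ [m' _ <-]; exact: bb.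
  move: h1 h2; move: (m.+1%:R^-1) (a ord0 i) (b m ord0 i) => r u v h1 h2.
  by rewrite ler_norml; apply/andP; split; lra.
have [d d0 dP] := bP m; exists d => // h hd.
rewrite [X in `|X| <= _](_ : _ = (F (x + h) - F x - dot (b m) h) +
  (dot (b m) h - dot a h)); last by ring.
apply: (le_trans (ler_normD _ _)).
have dh : `|dot (b m) h - dot a h| <= n%:R * m.+1%:R^-1 * `|h|.
  rewrite /dot -sumrB; apply: (le_trans (ler_norm_sum _ _ _)).
  rewrite [leRHS](_ : _ = \sum_(c < n) m.+1%:R^-1 * `|h|); last first.
    by rewrite sumr_const card_ord -mulrA mulr_natl.
  apply: ler_sum => c _.
  by rewrite -mulrBl normrM ler_pM// le_coord_norm.
apply: (le_trans (lerD (dP h hd) dh)); rewrite -mulrDl ler_wpM2r//.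
rewrite -[X in X + _]mul1r -mulrDl mulrC -ler_pdivlMr; first exact: ltW.
by rewrite ltr_wpDr.
Qed.

(** * Stepanov's theorem *)

(** The norm on row vectors is the sup norm; with [eucl_le] this gives its equivalence to the
    Euclidean one. *)
Lemma norm_le_eucl (R : realType) n (v : 'rV[R]_n) : `|v| <= eucl v.
Proof.
apply: norm_rV_le => [|i]; first exact: sqrtr_ge0.
rewrite -sqrtr_sqr; apply: ler_wsqrtr; rewrite (bigD1 i)//= lerDl.
by apply: sumr_ge0 => j _; exact: sqr_ge0.
Qed.

Lemma sum_sqr_le (R : realType) n (u : 'I_n -> R) (e : R) :
  (forall i, `|u i| <= e) -> \sum_i (u i) ^+ 2 <= (n%:R * e) ^+ 2.
Proof.
move=> ue; apply: (@le_trans _ _ (\sum_(i < n) e ^+ 2)).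
  apply: ler_sum => i _; rewrite -real_normK ?num_real// lerXn2r ?nnegrE//.
  exact: le_trans (ue i).
rewrite sumr_const card_ord exprMn -[leLHS]mulr_natl ler_wpM2r ?sqr_ge0//.
by rewrite -natrX ler_nat; case: n {u ue} => // n; rewrite -mulnn leq_pmull.
Qed.

Lemma eucl_le (R : realType) n (v : 'rV[R]_n) (e : R) :
  0 <= e -> (forall i, `|v ord0 i| <= e) -> eucl v <= n%:R * e.
Proof.
move=> e0 ve; rewrite -[leRHS]ger0_norm ?mulr_ge0// -sqrtr_sqr.
by apply: ler_wsqrtr; exact: sum_sqr_le.
Qed.

(** The minimum is attained by some matching, and each of its terms is at most the sum. *)
Lemma Gdist_le_perm (R : realType) Q k (A B : QTup R Q k) (K : R) :
  Gdist A B <= K -> exists s : {perm 'I_Q}, forall i, `|A i - B (s i)| <= K.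
Proof.
rewrite /Gdist; set mn := \big[_/_]_(_ : _) _ => mK.
have [s sm] : exists s, Gsq_perm A B s <= mn.
  have /bigmin_leP[h|[s _ h]] := lexx mn; first by exists 1%g.
  by exists s.
exists s => i; apply: le_trans mK; apply: (le_trans (norm_le_eucl _)).
rewrite -[leLHS]ger0_norm ?sqrtr_ge0// -sqrtr_sqr; apply: ler_wsqrtr.
apply: le_trans sm; rewrite /Gsq_perm (bigD1 i)//= lerDl.
by apply: sumr_ge0 => j _; exact: sqr_ge0.
Qed.

Lemma perm_Gdist_le (R : realType) Q k (A B : QTup R Q k) (e : R) (s : {perm 'I_Q}) :
  0 <= e -> (forall i c, `|A i ord0 c - B (s i) ord0 c| <= e) ->
  Gdist A B <= (Q * k)%:R * e.
Proof.
move=> e0 ABe; rewrite -[leRHS]ger0_norm ?mulr_ge0// -sqrtr_sqr.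
apply: ler_wsqrtr; apply: (le_trans (bigmin_le _ s _)).
rewrite natrM -mulrA; apply: sum_sqr_le => i; rewrite ger0_norm ?sqrtr_ge0//.
by apply: eucl_le => // c; rewrite !mxE.
Qed.

Lemma rat_row_approx (R : realType) n (v : 'rV[R]_n) (e : R) : 0 < e ->
  exists q : 'rV[rat]_n, `|v - map_mx ratr q| < e.
Proof.
move=> e0; have e2 : 0 < e / 2 by rewrite divr_gt0.
have /choice[q qP] : forall i, exists q : rat, ratr q \in `]v ord0 i, v ord0 i + e / 2[.
  by move=> i; apply: rat_in_itvoo; rewrite ltrDl.
exists (\row_i q i); apply: (@le_lt_trans _ _ (e / 2)); last first.
  by rewrite ltr_pdivrMr// ltr_pMr// ltr1n.
apply: norm_rV_le => [|i]; first exact: ltW.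
rewrite !mxE; move: (qP i); rewrite in_itv/=; move: (ratr _) => r /andP[? ?].
by rewrite ler_norml; apply/andP; split; lra.
Qed.

Lemma Lipf_lty (R : realType) n Q k (B : set 'rV[R]_n)
    (f : 'rV[R]_n -> QTup R Q k) x : (Lipf B f x < +oo)%E ->
  exists K d : R, 0 < d /\ forall y, B y -> `|y - x| < d ->
    exists s : {perm 'I_Q}, forall i, `|f y i - f x (s i)| <= K * `|y - x|.
Proof.
move=> /ereal_inf_lt[_ [d /= d0 <-]]; set M := ereal_sup _ => Moo.
(* [n] and [n.+1] convert between the Euclidean and sup norms; the successor keeps the divisor
   positive. *)
exists (`|fine M| * n%:R), (d / n.+1%:R); split; first by rewrite divr_gt0.
move=> y By yx; have [->|y_x] := eqVneq y x.
  by exists 1%g => i; rewrite perm1 !subrr !normr0 mulr0.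
have eucl_n : eucl (y - x) <= n%:R * `|y - x|.
  by apply: eucl_le => // i; exact: le_coord_norm.
have eucl0 : 0 < eucl (y - x).
  by apply: lt_le_trans (norm_le_eucl _); rewrite normr_gt0 subr_eq0.
apply: Gdist_le_perm.
have : ((Gdist (f y) (f x) / eucl (y - x))%:E <= M)%E.
  apply: ereal_sup_ubound; exists y => //=; split => //; rewrite eucl0/=.
  apply: (le_lt_trans eucl_n); move: yx; rewrite ltr_pdivlMr ?ltr0n//.
  by apply: le_lt_trans; rewrite mulrC ler_wpM2l// ler_nat.
move: Moo; case: M => [M _| |]//=; rewrite lee_fin ler_pdivrMr// => h.
apply: (le_trans h); apply: (le_trans (ler_wpM2r (ltW eucl0) (ler_norm M))).
by rewrite -mulrA ler_wpM2l.
Qed.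

(* With [s = 1/(m+1)], the values [f x i] lie within [s/8] of rational points that are
   fixed on the piece, while distinct values are [s]-separated: this is what makes the
   labelling consistent along the piece. *)
Definition piece (R : realType) n Q k (B : set 'rV[R]_n) (f : 'rV[R]_n -> QTup R Q k)
    (p : nat * {ffun 'I_Q -> 'rV[rat]_k} * 'rV[rat]_n) : set 'rV[R]_n :=
  let s := p.1.1.+1%:R^-1 in
  [set x | [/\ B x,
    (forall y, B y -> `|y - x| < s -> exists t : {perm 'I_Q},
       forall i, `|f y i - f x (t i)| <= p.1.1%:R * `|y - x|),
    (forall i j, f x i = f x j \/ s <= `|f x i - f x j|),
    (forall i, `|f x i - map_mx ratr (p.1.2 i)| < s / 8) &
    `|x - map_mx ratr p.2| < s / (8 * p.1.1.+1%:R)]].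

Lemma piece_cover (R : realType) n Q k (B : set 'rV[R]_n)
    (f : 'rV[R]_n -> QTup R Q k) x : A_f B f x -> exists p, piece B f p x.
Proof.
move=> [Bx /Lipf_lty[K [d [d0 fK]]]].
have [m1 m1d] := natSinv_lt d0.
have /choice[mm mmP] : forall ij : 'I_Q * 'I_Q, exists m : nat,
    f x ij.1 = f x ij.2 \/ m.+1%:R^-1 <= `|f x ij.1 - f x ij.2|.
  move=> [i j] /=; have [fij|fij] := eqVneq (f x i) (f x j); first by exists 0%N; left.
  have [|m /ltW mP] := @natSinv_lt R `|f x i - f x j|; last by exists m; right.
  by rewrite normr_gt0 subr_eq0.
(* One index serves for the radius, the Lipschitz constant and the separation of all pairs of
   values. *)
pose m := maxn (maxn m1 (Num.bound `|K|)) (\max_ij mm ij).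
have ms m' : (m' <= m)%N -> m.+1%:R^-1 <= m'.+1%:R^-1 :> R.
  by move=> m'm; rewrite lef_pV2 ?posrE ?ltr0n// ler_nat.
have s0 : (0 : R) < m.+1%:R^-1 by rewrite invr_gt0 ltr0n.
have s8 : (0 : R) < m.+1%:R^-1 / 8 by rewrite divr_gt0.
have [u xu] := @rat_row_approx R n x (m.+1%:R^-1 / (8 * m.+1%:R)) (ltac:(by rewrite divr_gt0)).
have /choice[q qP] : forall i, exists q : 'rV[rat]_k, `|f x i - map_mx ratr q| < m.+1%:R^-1 / 8.
  by move=> i; exact: rat_row_approx.
exists (m, [ffun i => q i], u); split => //=.
- move=> y By yx; have [|t tP] := fK y By.
    apply: (lt_trans yx); apply: le_lt_trans m1d; apply: ms.
    by rewrite /m -maxnA leq_maxl.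
  exists t => i; apply: (le_trans (tP i)); rewrite ler_wpM2r//.
  apply: (le_trans (ler_norm K)); rewrite ltW// (lt_le_trans (unstable.ltr_bound _))//.
  by rewrite ler_nat /m maxnAC leq_maxr.
- move=> i j; have [->|h] := mmP (i, j); [by left|right].
  apply: le_trans h; apply: ms; rewrite /m leq_max.
  by rewrite (@leq_bigmax _ mm (i, j)) orbT.
- by move=> i; rewrite ffunE.
Qed.

Section piece_labels.
Context (R : realType) (n Q k : nat) (B : set 'rV[R]_n) (f : 'rV[R]_n -> QTup R Q k).
Context (p : nat * {ffun 'I_Q -> 'rV[rat]_k} * 'rV[rat]_n).
Let s : R := p.1.1.+1%:R^-1.
Let q i : 'rV[R]_k := map_mx ratr (p.1.2 i).

Let s_gt0 : 0 < s. Proof. by rewrite invr_gt0 ltr0n. Qed.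

(** The values are closer than s/8 + s/2 + s/8 < s, which the separation allows only if they are
    equal. *)
Lemma piece_separated x i j : piece B f p x -> `|q i - q j| < s / 2 -> f x i = f x j.
Proof.
move=> [_ _ xs xq _] qij; have [//|abs] := xs i j; exfalso.
have : `|f x i - f x j| <= `|f x i - q i| + `|q i - q j| + `|f x j - q j|.
  rewrite (_ : f x i - f x j = (f x i - q i) + (q i - q j) - (f x j - q j)).
    by rewrite (le_trans (ler_normB _ _))// lerD2r (le_trans (ler_normD _ _)).
  by apply/rowP => c; rewrite !mxE; ring.
have := xq i; have := xq j; rewrite -/s -/(q i) -/(q j); move: s_gt0 abs qij.
by rewrite -/s; lra.
Qed.

Lemma piece_near x z i j : piece B f p x -> piece B f p z ->
  `|f x i - f z j| <= s / 4 -> `|q i - q j| < s / 2.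
Proof.
move=> [_ _ _ xq _] [_ _ _ zq _] fij.
have : `|q i - q j| <= `|f x i - q i| + `|f x i - f z j| + `|f z j - q j|.
  rewrite (_ : q i - q j = - (f x i - q i) + (f x i - f z j) + (f z j - q j)).
    by rewrite (le_trans (ler_normD _ _))// lerD2r (le_trans (ler_normD _ _))// normrN.
  by apply/rowP => c; rewrite !mxE; ring.
have := xq i; have := zq j; rewrite -/s -/(q i) -/(q j); move: s_gt0.
by lra.
Qed.

(** Coincidence of labels is read off the rational centres, which are common to the whole piece. *)
Lemma piece_eq x z i j : piece B f p x -> piece B f p z ->
  f x i = f x j -> f z i = f z j.
Proof.
move=> px pz fij; apply: (piece_separated pz); apply: (piece_near px px).
by rewrite fij subrr normr0 divr_ge0// ltW.
Qed.

(** The matching [t] at [z] may permute labels, but [f x i] and [f z (t i)] are within s/4, which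
    forces [f z (t i) = f z i]. *)
Lemma piece_lipschitz x z i : piece B f p x -> piece B f p z ->
  `|f x i - f z i| <= p.1.1%:R * `|x - z|.
Proof.
move=> px pz; have [Bx _ _ _ xu] := px; have [_ zlip _ _ zu] := pz.
have m0 : (0 : R) < p.1.1.+1%:R by rewrite ltr0n.
(* Both points are close to the same rational point, so that even (m+1) |x - z| stays below s/4. *)
have xz : `|x - z| < s / (4 * p.1.1.+1%:R).
  have : `|x - z| <= `|x - map_mx ratr p.2| + `|z - map_mx ratr p.2|.
    by rewrite (distrC z) (le_trans _ (ler_distD _ _ _)).
  have -> : s / (4 * p.1.1.+1%:R) = s / (8 * p.1.1.+1%:R) + s / (8 * p.1.1.+1%:R).
    by field; rewrite gt_eqF.
  by move=> h; apply: (le_lt_trans h); rewrite ltrD.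
have m1 : (1 : R) <= p.1.1.+1%:R by rewrite ler1n.
have xzs : `|x - z| * p.1.1.+1%:R < s / 4.
  by rewrite -ltr_pdivlMr// -mulrA -invfM.
have [|t tP] := zlip x Bx.
  apply: (@le_lt_trans _ _ (s / 4)); first by apply/ltW/(le_lt_trans _ xzs); rewrite ler_peMr.
  by rewrite -/s; move: s_gt0; lra.
rewrite (piece_separated pz (piece_near px pz (_ : `|f x i - f z (t i)| <= _)))//.
apply: (le_trans (tP i)); apply/ltW/(le_lt_trans _ xzs); rewrite mulrC.
by rewrite ler_wpM2l// ler_nat.
Qed.

End piece_labels.

(** * Differentiability at points of a piece *)

Lemma dot_norm_le (R : realType) n (a v : 'rV[R]_n) :
  `|dot a v| <= (\sum_c `|a ord0 c|) * `|v|.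
Proof.
rewrite /dot mulr_suml; apply: (le_trans (ler_norm_sum _ _ _)).
by apply: ler_sum => c _; rewrite normrM ler_wpM2l// le_coord_norm.
Qed.

(** A point [y] is replaced by a nearby [z] of the piece. The estimate at [z] matches [f y] with
    [f z], and the labels of [f z] are values of the differentiable functions [F]. *)
Lemma Qdifferentiable_piece (R : realType) n Q k (B : set 'rV[R]_n)
    (f : 'rV[R]_n -> QTup R Q k) p (F : 'I_Q -> 'I_k -> 'rV[R]_n -> R) x :
  (forall i c z, piece B f p z -> F i c z = f z i ord0 c) ->
  (forall i j, f x i = f x j -> F i = F j) ->
  piece B f p x -> approachable (piece B f p) setT x ->
  (forall i c, exists a, is_gradient (F i c) x a) ->
  Qdifferentiable B f x.
Proof.
move=> Ff Feq px apx gradF; pose s : R := p.1.1.+1%:R^-1.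
have s0 : 0 < s by rewrite invr_gt0 ltr0n.
(* The choice depends only on the function [F i c], so equal labels receive equal matrices. *)
pose a i c : 'rV[R]_n := xget 0 [set a | is_gradient (F i c) x a].
have aP i c : is_gradient (F i c) x (a i c).
  by have [b bP] := gradF i c; exact: (xgetI 0 bP).
exists (fun i => \matrix_(c, j) a i c ord0 j); split.
  by move=> i j /Feq Fij; apply/matrixP => c l; rewrite !mxE /a Fij.
pose A : R := \sum_i \sum_c \sum_j `|a i c ord0 j|.
have aA i c : \sum_j `|a i c ord0 j| <= A.
  rewrite /A (bigD1 i)//= (bigD1 c)//= -addrA lerDl addr_ge0//.
    by apply: sumr_ge0 => *; apply: sumr_ge0.
  by apply: sumr_ge0 => *; apply: sumr_ge0 => *; apply: sumr_ge0.
have A0 : 0 <= A by apply: sumr_ge0 => *; apply: sumr_ge0 => *; apply: sumr_ge0.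
(* The terms pay for matching [f y] with [f z], for the linear error at [w] (as [|w| <= 2 |h|]), and
   for replacing [w] by [h] in the linear part. *)
pose C : R := p.1.1%:R + 2 + A.
have C0 : 0 < C by rewrite ltr_wpDr// ltr_wpDl.
move=> e e0.
have QkC : 0 < (Q * k)%:R * C + 1 by rewrite ltr_wpDl// mulr_ge0// ltW.
pose e' := Num.min 1 (e / ((Q * k)%:R * C + 1)).
have e'0 : 0 < e' by rewrite lt_min ltr01 divr_gt0.
have e'1 : e' <= 1 by rewrite ge_min lexx.
have e'e : (Q * k)%:R * C * e' <= e.
  apply: (@le_trans _ _ (((Q * k)%:R * C + 1) * e')).
    by rewrite ler_wpM2r ?ltW// ltrDl.
  by rewrite mulrC -ler_pdivlMr// ge_min lexx orbT.
have [d1 d10 d1P] := apx e' e'0.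
have /choice[l lP] : forall ic : 'I_Q * 'I_k, exists l : nat, forall h, `|h| < l.+1%:R^-1 ->
    `|F ic.1 ic.2 (x + h) - F ic.1 ic.2 x - dot (a ic.1 ic.2) h| <= e' * `|h|.
  move=> [i c] /=; have [d d0 dP] := aP i c e' e'0; have [l ld] := natSinv_lt d0.
  by exists l => h hl; apply: dP; exact: lt_trans ld.
pose lm : R := (\max_ic l ic).+1%:R^-1.
have lm0 : 0 < lm by rewrite invr_gt0 ltr0n.
(* [lm / 2] allows for [|w| <= 2 |h|], and [s] brings [y] into the range of the estimate at [z]. *)
exists (Num.min d1 (Num.min (lm / 2) s)); first by rewrite !lt_min d10 s0 divr_gt0.
move=> y By; rewrite !lt_min => /andP[eyx0 /and3P[eyx1 eyx2 eyx3]].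
set h := y - x; have nh : `|h| <= eucl h by exact: norm_le_eucl.
have [z pz zy] := d1P h I (le_lt_trans nh eyx1).
have {}zy : `|z - y| <= e' * `|h| by move: zy; rewrite /h subrKC.
have yz : `|y - z| <= e' * `|h| by rewrite distrC.
have yz1 : `|y - z| <= `|h| by apply: (le_trans yz); rewrite ler_piMl.
have [_ zlip _ _ _] := pz.
have [t tP] := zlip y By (le_lt_trans yz1 (le_lt_trans nh eyx3)).
pose w := z - x.
have wh : `|w| <= 2 * `|h|.
  rewrite /w (_ : z - x = (z - y) + (y - x)); last by rewrite addrA subrK.
  apply: (le_trans (ler_normD _ _)); rewrite mulr2n mulrDl mul1r lerD2r.
  by rewrite distrC.
have wl ic : `|w| < (l ic).+1%:R^-1.
  apply: (le_lt_trans wh); apply: (@lt_le_trans _ _ lm).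
    by rewrite mulrC -ltr_pdivlMr// (le_lt_trans nh).
  by rewrite lef_pV2 ?posrE ?ltr0n// ler_nat ltnS; exact: leq_bigmax.
apply: (le_trans (@perm_Gdist_le _ _ _ _ _ (C * e' * `|h|) t _ _)).
- by rewrite !mulr_ge0// ltW.
- move=> i c; set j := t i.
  have -> : (f x j + ((\matrix_(c, l) a j c ord0 l) *m h^T)^T) ord0 c
      = f x j ord0 c + dot (a j c) h.
    by rewrite !mxE; congr (_ + _); apply: eq_bigr => b _; rewrite !mxE.
  have h1 : `|f y i ord0 c - f z j ord0 c| <= p.1.1%:R * (e' * `|h|).
    have := le_trans (le_coord_norm (f y i - f z j) c) (tP i); rewrite !mxE => H1.
    by apply: (le_trans H1); rewrite ler_wpM2l.
  have h2 : `|f z j ord0 c - f x j ord0 c - dot (a j c) w| <= 2 * (e' * `|h|).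
    have := lP (j, c) w (wl (j, c)); rewrite /= [x + w]subrKC !Ff// => H2.
    by apply: (le_trans H2); rewrite mulrCA ler_wpM2l// ltW.
  have h3 : `|dot (a j c) (z - y)| <= A * (e' * `|h|).
    apply: (le_trans (dot_norm_le _ _)); apply: ler_pM => //.
    by apply: sumr_ge0.
  rewrite [X in `|X| <= _](_ : _ = (f y i ord0 c - f z j ord0 c) +
    (f z j ord0 c - f x j ord0 c - dot (a j c) w) + dot (a j c) (z - y)); last first.
    rewrite (_ : w = (z - y) + h) ?dotDr; first by ring.
    by rewrite /w /h addrA subrK.
  rewrite -mulrA /C 2!mulrDl.
  apply: (le_trans (ler_normD _ _)); rewrite lerD//.
  by apply: (le_trans (ler_normD _ _)); rewrite lerD.
rewrite !mulrA; apply: ler_pM => //.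
by rewrite !mulr_ge0// ltW.
Qed.

(** The exceptional points are those not approachable from the piece, or where one of the finitely
    many extended components has no linear approximation. *)
Lemma Qdifferentiable_piece_ae (R : realType) n Q k (B : set 'rV[R]_n.+1)
    (f : 'rV[R]_n.+1 -> QTup R Q k) p :
  leb_null [set x | piece B f p x /\ ~ Qdifferentiable B f x].
Proof.
set S := piece B f p.
have [S0|/set0P S0] := eqVneq S set0.
  rewrite (_ : mkset _ = set0) ?/leb_null ?leb_outer0// -subset0 => x [].
  by rewrite S0.
have m0 : (0 : R) <= p.1.1%:R by [].
pose F i c := mcshane S (fun z => f z i ord0 c) p.1.1%:R.
have FS i c z w : S z -> S w ->
    `|f z i ord0 c - f w i ord0 c| <= p.1.1%:R * `|z - w|.
  move=> Sz Sw; apply: le_trans (piece_lipschitz i Sz Sw).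
  by apply: le_trans (le_coord_norm _ c); rewrite !mxE.
pose bad (o : option ('I_Q * 'I_k)) := match o with
  | None => [set x | S x /\ ~ approachable S setT x]
  | Some ic => [set x | ~ forall e, 0 < e -> exists a, linear_approx (F ic.1 ic.2) x a e]
  end.
have : leb_null (\bigcup_o bad o).
  apply: leb_null_countable => -[[i c]|]; last exact: approachable_ae.
  apply: (@linear_approx_ae _ _ _ p.1.1%:R) => x y.
  exact: (mcshane_lipschitz m0 (@FS i c) _ _ S0).
apply: leb_nullS => x [Sx]; apply: contra_notP => nbad.
apply: (@Qdifferentiable_piece _ _ _ _ B f p F x) => //.
- by move=> i c z Sz; exact: (mcshane_id m0 (@FS i c)).
- move=> i j fij; apply/funext => c; apply: eq_mcshane => z Sz.
  by rewrite (piece_eq Sx Sz fij).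
- by apply: contrapT => na; apply: nbad; exists None.
- move=> i c; apply: gradient_exists; apply: contrapT => na.
  by apply: nbad; exists (Some (i, c)).
Qed.

Theorem theorem1p2 (R : realType) (n k Q : nat) (hn : (0 < n)%N)
  (hk : (0 < k)%N) (hQ : (0 < Q)%N) (B : set 'rV[R]_n)
  (f : 'rV[R]_n -> QTup R Q k) :
  leb_measurable B -> no_isolated B -> Qmeasurable B f ->
  exists N : set 'rV[R]_n, leb_null N /\
    forall x, A_f B f x -> ~ N x -> Qdifferentiable B f x.
Proof.
case: n hn B f => // n _ B f _ _ _.
(* The pieces cover [A_f] and are indexed by a countable type. *)
exists (\bigcup_p [set x | piece B f p x /\ ~ Qdifferentiable B f x]); split.
  by apply: leb_null_countable => p; exact: Qdifferentiable_piece_ae.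
move=> x /piece_cover[p px] nx; apply: contrapT => nd.
by apply: nx; exists p.
Qed.
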